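(* Let $T,R>0$, $\alpha>1$, $\lambda,\mu>0$, and let $N$ be a fixed positive integer. Consider the optimal reward scheduling problem without exploitative rewards described in the context. The optimal reward schedule is $$T_i=\frac TN,\qquad R_i=\frac RN,\qquad \theta_i=R_i^{\frac1\alpha}F(T_i)^{\frac{\alpha-1}\alpha}\qquad(i=1,\dots,N),$$ where $$F(T):=\begin{cases}F_1(T)&\text{if }T\le\frac{x_0^{\alpha-1}-1}\lambda,\\ F_2(T)&\text{if }T>\frac{x_0^{\alpha-1}-1}\lambda,\end{cases}\qquad F_1(T):=f_T(0)^{-\frac1{\alpha-1}},\qquad F_2(T):=f_T\left(T-\frac{x_0^{\alpha-1}-1}\lambda\right)^{-\frac1{\alpha-1}},$$ with $f_T$ and $x_0$ as in the context. The optimal objective function value $\sum_{i=1}^NP_i$ equals $$G(N):=R^{\frac1\alpha}\left(N\cdot F\left(\frac TN\right)\right)^{\frac{\alpha-1}\alpha}.$$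
   Context: Single-stage agent model with horizon $T$, reward $R$, goal $\theta$. Discount function: $\gamma_t(s)=(1+\lambda(s-t))^{-\mu/\lambda}$. Cost function: $c(\Delta)=\Delta^\alpha$ if $\Delta\ge0$ and $c(\Delta)=+\infty$ if $\Delta<0$. For $t\in[0,T)$ and $x\ge0$, $\mathcal Y_{t,x}$ is the set of absolutely continuous functions $y:[t,T]\to\mathbb R$ with $y(t)=x$. The perceived cost of $y\in\mathcal Y_{t,x}$ is $$\mathcal P[y]=\int_t^T\gamma_t(s)\,c(y'(s))\,ds-\gamma_t(T)\,R\cdot\mathbf 1[y(T)\ge\theta].$$ Let $y^*_{t,x}$ be a minimizer of $\mathcal P$ over $\mathcal Y_{t,x}$; if the minimizer is not unique, one with the largest initial derivative at $s=t$ is chosen. The agent's trajectory is the absolutely continuous $x:[0,T]\to\mathbb R$ with $x(0)=0$ and $x'(t)=\frac{d}{ds}y^*_{t,x(t)}(s)\big|_{s=t}$ for almost every $t\in[0,T]$; the final progress is $x(T)$ (a stage of length $0$ produces final progress $0$). Optimal reward scheduling problem with fixed $N$ (non-exploitative). Choose $T_i\ge0$, $R_i\ge0$, $\theta_i\ge0$ ($i=1,\dots,N$) with $\sum_iT_i=T$ and $\sum_iR_i=R$. In stage $i$ the agent acts independently of the other stages, according to the single-stage model with horizon $T_i$, reward $R_i$, goal $\theta_i$, starting from time $0$ and progress $0$; $P_i$ is the resulting final progress of stage $i$. Exploitative rewards are not allowed: it is required that $P_i=\theta_i$ for every $i$. The objective is to maximize $\sum_{i=1}^NP_i$. Definitions.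 For $T>0$ and $t\in[0,T)$, $$f_T(t):=\left(\frac{\mu+\lambda(\alpha-1)}{(\alpha-1)\left[\bigl(1+\lambda(T-t)\bigr)^{\frac{\mu}{\lambda(\alpha-1)}+1}-1\right]}\right)^{\alpha-1}\bigl(1+\lambda(T-t)\bigr)^{\frac{\mu}{\lambda}}\exp\left(-\alpha\left(\frac{\mu}{\alpha-1}+\lambda\right)\int_0^t\frac{ds}{\bigl(1+\lambda(T-s)\bigr)^{\frac{\mu}{\lambda(\alpha-1)}+1}-1}\right);$$ $F(0):=0$ (the limit of $F_1$ at $0$). $x_0$ denotes the unique real solution with $x>1$ of $$(\alpha-1)x^{\frac{\mu}{\lambda}+\alpha-1}-\alpha\left(\frac{\mu}{\lambda(\alpha-1)}+1\right)x^{\alpha-1}+\frac{\mu}{\lambda}=0.$$ *)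

(* Defs.v *)
From HB Require Import structures.
From mathcomp Require Import all_boot all_order all_algebra.
From mathcomp Require Import all_classical all_reals all_analysis.
Set Implicit Arguments.
Unset Strict Implicit.
Unset Printing Implicit Defensive.
Import Order.TTheory GRing.Theory Num.Theory.
Import numFieldNormedType.Exports.
Local Open Scope classical_set_scope.
Local Open Scope ring_scope.

(* Functions on a closed interval are represented by total functions R -> R;
   their values outside the interval are irrelevant to all notions below (up
   to the two endpoints, where two-sided derivatives are only used almost
   everywhere). *)
Definition absolutely_continuous_on (R : realType) (a b : R) (f : R -> R) : Prop :=
  forall e : R, 0 < e -> exists2 d : R, 0 < d &
    forall (n : nat) (u v : 'I_n -> R),
      (forall i, a <= u i /\ u i <= v i /\ v i <= b) ->
      trivIset setT (fun i => `]u i, v i[%classic) ->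
      \sum_(i < n) (v i - u i) < d ->
      \sum_(i < n) `|f (v i) - f (u i)| < e.

Definition right_derivative_at (R : realType) (f : R -> R) (t d : R) : Prop :=
  (f s - f t) / (s - t) @[s --> t^'+] --> d.

Section Agent.
Context {R : realType}.
Variables (alpha lambda mu : R).

Definition discount (t s : R) : R := (1 + lambda * (s - t)) `^ (- (mu / lambda)).

Definition cost (D : R) : \bar R := if 0 <= D then (D `^ alpha)%:E else +oo%E.

Section SingleStage.
Variables (T rew theta : R).

Definition plans (t x : R) : set (R -> R) :=
  [set y | absolutely_continuous_on t T y /\ y t = x].

Definition perceived_cost (t : R) (y : R -> R) : \bar R :=
  (\int[lebesgue_measure]_(s in `[t, T]) ((discount t s)%:E * cost (derive1 y s))
   - (discount t T * rew * (theta <= y T)%R%:R)%:E)%E.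

Definition minimizer (t x : R) (y : R -> R) : Prop :=
  plans t x y /\
  forall z, plans t x z -> (perceived_cost t y <= perceived_cost t z)%E.

(* [d] is the initial derivative of the minimizer selected at (t, x), i.e. of
   one whose initial derivative is largest among all minimizers. *)
Definition chosen_speed (t x d : R) : Prop :=
  exists y, [/\ minimizer t x y, right_derivative_at y t d &
    forall z e, minimizer t x z -> right_derivative_at z t e -> e <= d].

Definition trajectory (x : R -> R) : Prop :=
  [/\ absolutely_continuous_on 0 T x, x 0 = 0 &
      {ae lebesgue_measure, forall t : R, t \in `[0, T[ ->
         exists2 d : R, is_derive t 1 x d & chosen_speed t (x t) d}].

(* A relation rather than a function: for exceptional goals, at which the agent
   is indifferent between working and giving up at a single instant, the
   almost-everywhere equation of motion has several solutions. *)
Definition final_progress (P : R) : Prop :=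
  (T = 0 /\ P = 0) \/ (0 < T /\ exists2 x, trajectory x & P = x T).

End SingleStage.

Record schedule (N : nat) := Schedule {
  horizon : 'I_N -> R;
  reward : 'I_N -> R;
  goal : 'I_N -> R }.

(* [P] lists the final progresses of the stages of [S]; [P i = goal S i]
   excludes exploitative rewards. *)
Definition feasible (N : nat) (T rew : R) (S : schedule N) (P : 'I_N -> R) : Prop :=
  [/\ forall i, [/\ 0 <= horizon S i, 0 <= reward S i & 0 <= goal S i],
      \sum_(i < N) horizon S i = T,
      \sum_(i < N) reward S i = rew,
      forall i, final_progress (horizon S i) (reward S i) (goal S i) (P i) &
      forall i, P i = goal S i].

Definition optimal (N : nat) (T rew : R) (S : schedule N) (P : 'I_N -> R) : Prop :=
  feasible T rew S P /\
  forall (S' : schedule N) (P' : 'I_N -> R), feasible T rew S' P' ->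
    \sum_(i < N) P' i <= \sum_(i < N) P i.

Definition fT (T t : R) : R :=
  ((mu + lambda * (alpha - 1)) /
   ((alpha - 1) *
    ((1 + lambda * (T - t)) `^ (mu / (lambda * (alpha - 1)) + 1) - 1)))
      `^ (alpha - 1)
  * (1 + lambda * (T - t)) `^ (mu / lambda)
  * expR (- (alpha * (mu / (alpha - 1) + lambda) *
      \int[lebesgue_measure]_(s in `[0, t])
        ((1 + lambda * (T - s)) `^ (mu / (lambda * (alpha - 1)) + 1) - 1)^-1)).

Definition x0_equation (x : R) : Prop :=
  (alpha - 1) * x `^ (mu / lambda + alpha - 1)
  - alpha * (mu / (lambda * (alpha - 1)) + 1) * x `^ (alpha - 1)
  + mu / lambda = 0.

Definition x0 : R := get [set x | 1 < x /\ x0_equation x].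

Definition Tcrit : R := (x0 `^ (alpha - 1) - 1) / lambda.

Definition F1 (T : R) : R := (fT T 0) `^ (- (alpha - 1)^-1).

Definition F2 (T : R) : R := (fT T (T - Tcrit)) `^ (- (alpha - 1)^-1).

(* [fT] divides by zero at T = t = 0, whence the separate value at 0. *)
Definition F (T : R) : R :=
  if T == 0 then 0 else if T <= Tcrit then F1 T else F2 T.

Definition G (T rew : R) (N : nat) : R :=
  rew `^ (alpha^-1) * (N%:R * F (T / N%:R)) `^ ((alpha - 1) / alpha).

Definition uniform_schedule (T rew : R) (N : nat) : schedule N :=
  {| horizon := fun=> T / N%:R;
     reward := fun=> rew / N%:R;
     goal := fun=> (rew / N%:R) `^ (alpha^-1)
                   * (F (T / N%:R)) `^ ((alpha - 1) / alpha) |}.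

End Agent.

(* Main.v *)
(** By Hölder, an agent at distance [D] from the goal with time [T - t] left
    pays at least [D ^ alpha K (t)] to reach it, with equality only for a speed
    proportional to [(1 + lambda (s - t)) ^ (mu / (lambda (alpha - 1)))]; the
    lower bound rests on the fundamental theorem of calculus for absolutely
    continuous functions, obtained from Radon-Nikodym and Lebesgue
    differentiation.  Hence the agent works at [t] iff
    [D ^ alpha K (t) <= gamma_t (T) R], once it rests it rests for ever, and
    while it works [D] solves a linear differential equation.  So a goal [theta] is reached iff
    [theta ^ alpha f_T (t) <= R] for all [t < T], i.e. iff
    [theta <= R ^ (1 / alpha) F (T) ^ ((alpha - 1) / alpha)], since [f_T] peaks
    when the remaining time is [(x0 ^ (alpha - 1) - 1) / lambda].  Finally [F]
    is strictly concave, being of class C^1 with strictly decreasing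
    derivative, and AM-GM together with tangents of [F] bounds the sum of the
    goals, with equality only for the uniform schedule. *)

From HB Require Import structures.
Require Import Defs.
From mathcomp Require Import all_boot all_order all_algebra.
From mathcomp Require Import all_classical all_reals all_analysis.
From mathcomp Require Import measurable_realfun.
From mathcomp Require Import ring lra.
Import Order.TTheory GRing.Theory Num.Theory.
Import numFieldNormedType.Exports.
Set Implicit Arguments.
Unset Strict Implicit.
Unset Printing Implicit Defensive.
Local Open Scope classical_set_scope.
Local Open Scope ring_scope.

(** * Total variation of absolutely continuous functions *)

(** Hölder's bound is proved pointwise: the power cost is replaced by its tangent at the optimal
    speed. The discounted marginal cost is the same at all times along the optimal plan, so the
    linearised cost of a competitor depends on it only through its displacement. Strict convexity
    then identifies every minimizer at each point of [t, T] and not merely almost everywhere; this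
    matters because the agent's speed is a right derivative at the single point t.

    The agent does not follow its own plans: it discounts afresh at every instant, so a working
    agent at distance D moves at speed D / [effort] (T - t). The quantity theta^alpha f_T(t) is the
    least reward for which an agent that has worked since time 0 still finds the goal worthwhile at
    t.

    The equation of motion may have several solutions. The necessary condition on the goal is
    therefore derived for every trajectory that ends at the goal, whereas for sufficiency one
    trajectory is exhibited, that of an agent who never rests. *)

Section AbsoluteContinuity.
Context {R : realType}.
Implicit Types (a b e : R) (f g : R -> R) (s : seq (R * R)).

Definition separated (x y : R * R) := (x.2 <= y.1) || (y.2 <= x.1).

(** Finite families of segments are encoded as lists, so that cutting a segment into pieces is a
    mere concatenation. *)
Definition admissible a b s :=
  all (fun x => [&& a <= x.1, x.1 <= x.2 & x.2 <= b]) s && pairwise separated s.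

Lemma absolutely_continuous_seq a b f : absolutely_continuous_on a b f ->
  forall e, 0 < e -> exists2 d : R, 0 < d & forall s, admissible a b s ->
    \sum_(x <- s) (x.2 - x.1) < d -> \sum_(x <- s) `|f x.2 - f x.1| < e.
Proof.
move=> acf e e0; have [d d0 hd] := acf e e0; exists d => // s /andP[/allP sab sep].
rewrite [X in X < d -> _]big_tnth [X in _ -> X < e]big_tnth => sd.
apply: (hd (size s) (fun i => (tnth (in_tuple s) i).1)
  (fun i => (tnth (in_tuple s) i).2)) => //.
  by move=> i; have /and3P[-> -> ->] := sab _ (mem_tnth i (in_tuple s)).
have key (i j : 'I_(size s)) : (i < j)%N ->
    separated (tnth (in_tuple s) i) (tnth (in_tuple s) j).
  move=> ij; rewrite !(tnth_nth (0, 0)) /=.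
  by move/(pairwiseP (0, 0)) : sep; apply => //; rewrite inE ltn_ord.
move=> i j _ _ [x [/=]]; rewrite !in_itv/= => /andP[ix xi] /andP[jx xj].
apply/val_inj/eqP; rewrite eqn_leq; apply/andP; split; rewrite leqNgt; apply/negP.
- move/key => /orP[le|le].
    by have := lt_trans (lt_le_trans xj le) ix; rewrite ltxx.
  by have := lt_trans (lt_le_trans xi le) jx; rewrite ltxx.
- move/key => /orP[le|le].
    by have := lt_trans (lt_le_trans xi le) jx; rewrite ltxx.
  by have := lt_trans (lt_le_trans xj le) ix; rewrite ltxx.
Qed.

Lemma itv_partition_pairs a b f (p : seq R) : itv_partition a b p ->
  let s := zip (a :: p) p in
  [/\ admissible a b s, \sum_(x <- s) (x.2 - x.1) = b - a &
      \sum_(x <- s) `|f x.2 - f x.1| = variation a b f p].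
Proof.
move=> abp /=; rewrite variation_zip//; case: abp => + /eqP.
elim: p a => [a _ /= -> |h t ih a /= /andP[ah ht] lb].
  by rewrite !big_nil subrr.
have hb : h <= b by rewrite -lb; exact: (itv_partition_le (conj ht (eqxx _))).
have [/andP[/allP A1 A2] S V] := ih _ ht lb.
rewrite !big_cons /= S V; split; last by rewrite distrC.
  apply/andP; split => /=.
    rewrite lexx (ltW ah) hb/=; apply/allP => x /A1 /and3P[hx -> ->].
    by rewrite (le_trans (ltW ah) hx).
  rewrite A2 andbT; apply/allP => x /A1 /and3P[hx _ _].
  by rewrite /separated /= hx.
by rewrite addrC addrA subrK.
Qed.

Lemma admissible_refine a b f (x : R * R) s p :
  admissible a b (x :: s) -> itv_partition x.1 x.2 p ->
  let r := zip (x.1 :: p) p in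
  [/\ admissible a b (s ++ r),
      \sum_(y <- s ++ r) (y.2 - y.1) = \sum_(y <- x :: s) (y.2 - y.1) &
      \sum_(y <- s ++ r) `|f y.2 - f y.1| =
        variation x.1 x.2 f p + \sum_(y <- s) `|f y.2 - f y.1|].
Proof.
move=> xs xp r; have [/andP[/allP R1 R2] RS RV] := itv_partition_pairs f xp.
rewrite !big_cat !big_cons RS RV /= addrC; split => //; last by rewrite addrC.
move: xs => /andP[/= /andP[/and3P[ax _ xb] A] /andP[/allP xs P]].
rewrite /admissible all_cat A/= pairwise_cat P R2 !andbT; apply/andP; split.
  apply/allP => y /R1 /and3P[xy -> yx].
  by rewrite (le_trans ax xy) (le_trans yx xb).
apply/allrelP => y z ys zr.
have /and3P[xz _ zx] := R1 _ zr.
have /orP[le|le] := xs _ ys; apply/orP; first by right; exact: le_trans le.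
by left; exact: le_trans xz.
Qed.

(** Induction on [K]: the head segment is cut by an arbitrary partition whose pieces join [L], and
    then the supremum over partitions is taken. The total length never changes, so the bound assumed
    for increments passes to total variations. With [L] empty this yields the absolute continuity of
    the variation function. *)
Lemma total_variation_seq a b f (d e : R) :
  (forall s, admissible a b s -> \sum_(x <- s) (x.2 - x.1) < d ->
     \sum_(x <- s) `|f x.2 - f x.1| <= e) ->
  forall K L, admissible a b (K ++ L) ->
    \sum_(x <- K ++ L) (x.2 - x.1) < d ->
  (\sum_(x <- K) total_variation x.1 x.2 f +
   (\sum_(x <- L) `|f x.2 - f x.1|)%:E <= e%:E)%E.
Proof.
move=> H; elim => [L AL LD|x K ih L AL LD].
  by rewrite big_nil add0e lee_fin; exact: H.
have /andP[/= /andP[/and3P[_ + _] AA] _] := AL.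
rewrite big_cons le_eqVlt => /predU1P[x12|x12].
  rewrite x12 total_variationxx add0e; apply: ih.
    by move: AL; rewrite /admissible /= => /andP[/andP[_ ->] /andP[_ ->]].
  by move: LD; rewrite /= big_cons x12 subrr add0r.
have K0 : (0 <= \sum_(y <- K) total_variation y.1 y.2 f)%E.
  rewrite big_seq; apply: sume_ge0 => y yK; apply: total_variation_ge0.
  by move/allP : AA => /(_ y); rewrite mem_cat yK/= => /(_ isT) /and3P[].
have step p : itv_partition x.1 x.2 p ->
  ((variation x.1 x.2 f p)%:E + (\sum_(y <- K) total_variation y.1 y.2 f +
     (\sum_(y <- L) `|f y.2 - f y.1|)%:E) <= e%:E)%E.
  move=> xp; have [A S V] := admissible_refine f AL xp.
  rewrite -catA in A S V.
  have := ih _ A; rewrite S => /(_ LD).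
  suff -> : \sum_(y <- L ++ zip (x.1 :: p) p) `|f y.2 - f y.1| =
    variation x.1 x.2 f p + \sum_(y <- L) `|f y.2 - f y.1|.
    by rewrite EFinD addeCA.
  move: V; rewrite !big_cat/= => V.
  by apply: (addrI (\sum_(y <- K) `|f y.2 - f y.1|)); rewrite V addrCA.
(* Subtraction in the extended reals requires finiteness, which the trivial partition already
   provides. *)
have Kfin : (\sum_(y <- K) total_variation y.1 y.2 f)%E \is a fin_num.
  have := step _ (itv_partition1 x12); case: (\sum_(y <- K) _)%E K0 => [//|_|//].
  by rewrite addye.
rewrite -addeA -leeBrDr ?fin_numD ?Kfin//; apply: ge_ereal_sup => _ [_ [p xp <-] <-].
by rewrite leeBrDr ?fin_numD ?Kfin//; exact: step.
Qed.

End AbsoluteContinuity.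

(** * Densities of absolutely continuous functions *)

Section MonotoneDensity.
Context {R : realType}.
Variables (a b : R) (phi : R -> R).
Hypotheses (ab : a < b) (ndphi : {homo phi : x y / x <= y})
  (phia : forall x, x <= a -> phi x = phi a) (phib : forall x, b <= x -> phi x = phi b)
  (acphi : absolutely_continuous_on a b phi).

Let clamp (x : R) := Num.max a (Num.min b x).

Let phi_clamp x : phi (clamp x) = phi x.
Proof.
rewrite /clamp; case: (leP b x) => bx.
  by rewrite (max_idPr (ltW ab)) phib.
by case: (leP x a) => ax //; rewrite [RHS]phia.
Qed.

Let clampP x y : x <= y -> [&& a <= clamp x, clamp x <= clamp y & clamp y <= b].
Proof.
move=> xy; apply/and3P; split.
- by rewrite /clamp le_max lexx.
- by rewrite /clamp; case: (leP b x); case: (leP b y); case: (leP a x); case: (leP a y);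
  case: (leP a b); lra.
- by rewrite /clamp ge_max ltW//= ge_min lexx.
Qed.

Let clampB x y : x <= y -> clamp y - clamp x <= y - x.
Proof.
by move=> xy; rewrite /clamp; case: (leP b x); case: (leP b y); case: (leP a x);
  case: (leP a y);
  case: (leP a b); lra.
Qed.

Let unif (e : R) : 0 < e -> exists2 d : R, 0 < d & forall x y : R,
  x <= y -> y - x < d -> phi y - phi x < e.
Proof.
move=> e0; have [d d0 H] := absolutely_continuous_seq acphi e0; exists d => // x y xy yxd.
have := H [:: (clamp x, clamp y)]; rewrite !big_cons !big_nil !addr0 /= !phi_clamp.
rewrite ger0_norm ?subr_ge0 ?ndphi//; apply; last exact: le_lt_trans (clampB xy) yxd.
by rewrite /admissible /= !andbT clampP.
Qed.

Let rc_phi x : phi @ at_right x --> phi x.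
Proof.
apply/(@cvgrPdist_lt _ R^o) => e e0; have [d d0 H] := unif e0.
near=> y; have xy : x <= y by near: y; exact: nbhs_right_ge.
rewrite distrC ger0_norm ?subr_ge0 ?ndphi//; apply: H => //.
by rewrite ltrBlDl; near: y; apply: nbhs_right_lt; rewrite ltrDl.
Unshelve. all: by end_near. Qed.

HB.instance Definition _ := isCumulative.Build R _ R phi ndphi rc_phi.

Let nu : {measure set (measurableTypeR R) -> \bar R} :=
  lebesgue_stieltjes_measure (phi : cumulative R R).

Let nu_oc x y : x <= y -> nu `]x, y]%classic = (phi y - phi x)%:E.
Proof.
move=> xy; rewrite /nu /= /lebesgue_stieltjes_measure/= /measure_extension/=.
rewrite measurable_mu_extE//; last exact: is_ocitv.
by rewrite -[LHS]/(wlength phi `]x, y]%classic) wlength_itv_bnd.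
Qed.

Let nu_ab_lty : (nu `]a, b]%classic < +oo)%E.
Proof. by rewrite nu_oc ?ltry ?ltW. Qed.

(** This turns the trace of an open interval on []a, b]] into a segment to which absolute continuity
    applies: the endpoints are the infimum and the supremum of the trace, or [a] twice if the trace
    is empty. *)
Let J_bounds (I : set R) : open I -> is_interval I -> exists uv : R * R,
  [/\ a <= uv.1 /\ uv.1 <= uv.2 /\ uv.2 <= b, `]uv.1, uv.2[%classic `<=` I &
    (nu (I `&` `]a, b]%classic) <= (phi uv.2 - phi uv.1)%:E)%E].
Proof.
move=> oI iI; set J := I `&` _.
have mJ : measurable J by apply: measurableI => //;
  exact: measurable_realfun.open_measurable.
have [J0|/set0P[x0 Jx0]] := eqVneq J set0.
  exists (a, a); rewrite J0 measure0 subrr; split => /=; [by rewrite lexx ltW| |by []].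
  by move=> x /=; rewrite in_itv/= => /andP[+ /ltW]; rewrite leNgt => ->.
have ubJ : has_ubound J by exists b => x -[_ /=]; rewrite in_itv/= => /andP[].
have lbJ : has_lbound J by exists a => x -[_ /=]; rewrite in_itv/= => /andP[/ltW].
have hs : has_sup J by split => //; exists x0.
have hi : has_inf J by split => //; exists x0.
exists (inf J, sup J) => /=; split.
- split; [|split].
  + by apply: lb_le_inf; [exists x0|move=> x -[_ /=]; rewrite in_itv/= => /andP[/ltW]].
  + by apply: (@le_trans _ _ x0); [exact: ge_inf|exact: ub_le_sup].
  + by apply: ge_sup; [exists x0|move=> x -[_ /=]; rewrite in_itv/= => /andP[]].
- move=> x /=; rewrite in_itv/= => /andP[ix xs].
  have [y Jy xy] := sup_gt (ex_intro _ _ Jx0) xs.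
  have [z Jz zx] := inf_lt (ex_intro _ _ Jx0) ix.
  by apply: (iI z y (proj1 Jz) (proj1 Jy)); rewrite !ltW.
- apply/lee_addgt0Pr => e e0; have [d d0 H] := unif e0.
  have d2 : 0 < d / 2 by rewrite divr_gt0.
  have iJs : inf J <= sup J by apply: (@le_trans _ _ x0); [exact: ge_inf|exact: ub_le_sup].
  (* The measure is only computed on left-open intervals. Widening [J] to the left by [d / 2] avoids
     asking whether it contains its infimum, and costs less than [e] by uniform continuity. *)
  apply: (@le_trans _ _ (nu `]inf J - d / 2, sup J]%classic)).
    apply: le_measure; rewrite ?inE//.
    move=> x Jx /=; rewrite in_itv/= ub_le_sup// andbT.
    by rewrite (lt_le_trans _ (ge_inf lbJ Jx))// ltrBlDr ltrDl.
  have iJ : inf J - d / 2 <= inf J by rewrite lerBlDr lerDl ltW.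
  rewrite nu_oc ?(le_trans iJ)//.
  rewrite -EFinD lee_fin.
  have := H _ _ iJ; rewrite opprB subrKC [d / 2 < d]ltr_pdivrMr// ltr_pMr//
    ltr1n => /(_ isT).
  by lra.
Qed.

(** A null set lies in an open set of length below [d], a countable disjoint union of open
    intervals. Absolute continuity bounds the measure of the first [n] of them by [e], uniformly in
    [n]. *)
Let nu_dominates A : measurable A -> lebesgue_measure A = 0%E -> nu (A `&` `]a,
  b]%classic) = 0%E.
Proof.
move=> mA A0; apply/eqP; rewrite eq_le measure_ge0 andbT.
apply/lee_addgt0Pr => e e0; rewrite add0e.
have [d d0 H] := acphi e0.
have [|U [oU AU Ud]] := lebesgue_regularity_outer mA _ d0;
  first by rewrite [X in (X < _)%E]A0 ltry.
have mU : measurable U by exact: measurable_realfun.open_measurable.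
have muU : (lebesgue_measure U < d%:E)%E.
  rewrite -(setDUK AU) measureU//;
    [|exact: measurableD|by rewrite setDE setICA setICr setI0].
  by rewrite [X in (X + _)%E]A0 add0e.
pose W := open_disjoint_itv oU.
have oI i : open (W i) by exact: (@open_disjoint_itv_open _ _ oU).
have mI i : measurable (W i) by exact: measurable_realfun.open_measurable.
have /choice[uv uvP] := fun i => J_bounds (oI i) (@open_disjoint_itv_is_interval _ _ oU i).
apply: (@le_trans _ _ (nu (U `&` `]a, b]%classic))).
  apply: le_measure; rewrite ?inE//; [exact: measurableI|exact: measurableI|exact: setSI].
rewrite [X in nu (X `&` _)](open_disjoint_itv_bigcup oU) setI_bigcupl.
have tW := @open_disjoint_itv_trivIset _ _ oU.
rewrite measure_bigcup; last first.
- exact: trivIset_setIr.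
- by move=> i _; apply: (@measurableI _ (measurableTypeR R));
  [exact: mI|exact: measurable_itv].
apply: lime_le; first exact: is_cvg_nneseries.
apply: nearW => n.
rewrite big_mkord.
apply: (@le_trans _ _ (\sum_(i < n) (phi (uv i).2 - phi (uv i).1)%:E)%E).
  rewrite (eq_bigl xpredT); last by move=> i; rewrite in_setT.
  by apply: lee_sum => i _; have [] := uvP i.
rewrite sumEFin lee_fin.
apply: le_trans (ltW (H n (fun i => (uv i).1) (fun i => (uv i).2) _ _ _)).
- by apply: ler_sum => i _; exact: ler_norm.
- by move=> i; have [] := uvP i.
- move=> i j _ _ [x [xi xj]]; apply/val_inj; apply: (tW i j I I).
  by exists x; split; [have [_ + _] := uvP i; apply|have [_ + _] := uvP j; apply].
rewrite -lte_fin; apply: le_lt_trans muU.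
have -> : lebesgue_measure U = (\sum_(i <oo) lebesgue_measure (W i))%E.
  rewrite [X in lebesgue_measure X](open_disjoint_itv_bigcup oU) measure_bigcup//=.
    by apply: eq_eseriesl => i; rewrite in_setT.
  by move=> i _; exact: mI.
rewrite -sumEFin.
apply: (@le_trans _ _ (\sum_(i < n) lebesgue_measure (W i))%E).
  apply: lee_sum => i _; have [[_ [uvi _]] sub _] := uvP i.
  apply: (@le_trans _ _ (lebesgue_measure `](uv i).1, (uv i).2[%classic)).
    rewrite lebesgue_measure_itv/= lte_fin; case: ltP => //.
    by rewrite lee_fin subr_le0.
  by apply: le_measure => //; rewrite inE; [exact: measurable_itv|exact: mI].
rewrite -(big_mkord xpredT (fun i => lebesgue_measure (W i))).
by apply: nneseries_lim_ge.
Qed.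

Lemma nondecreasing_density : exists2 g : R -> R,
  lebesgue_measure.-integrable setT (EFin \o g) &
  forall x, a <= x -> x <= b -> phi x - phi a = \int[lebesgue_measure]_(t in `]a, x]) g t.
Proof.
have mab : @measurable _ (measurableTypeR R) `]a, b]%classic by exact: measurable_itv.
pose nu_ab : {finite_measure set (measurableTypeR R) -> \bar R} :=
  @mfrestr _ (measurableTypeR R) R _ nu mab nu_ab_lty.
have dom : nu_ab `<< (@lebesgue_measure R).
  by apply/null_content_dominatesP => A mA A0; exact: nu_dominates.
have [f [f0 ffin fint fE]] := radon_nikodym_sigma_finite dom.
exists (fine \o f).
  by rewrite (_ : EFin \o _ = f)//; apply/funext => x /=; rewrite fineK.
move=> x ax xb; have := fE `]a, x]%classic (measurable_itv _).
rewrite /nu_ab /= /mfrestr /mrestr.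
rewrite setIidl; last first.
  by move=> y /=; rewrite !in_itv/= => /andP[-> yx]/=; exact: le_trans xb.
move=> /= nuE; rewrite -[LHS]/(fine (phi x - phi a)%:E) -nu_oc// [nu _]nuE /Rintegral.
by congr fine; apply: eq_integral => y _ /=; rewrite fineK.
Qed.

End MonotoneDensity.

Section Density.
Context {R : realType}.
Implicit Types (a b : R) (f : R -> R).

(** A degenerate segment has empty interior, so disjointness says nothing about its position and it
    may lie inside another one. Such segments are dropped from the list; since [F] vanishes on the
    diagonal, no sum changes. *)
Lemma admissible_ord a b n (u v : 'I_n -> R) :
  (forall i, a <= u i /\ u i <= v i /\ v i <= b) ->
  trivIset setT (fun i => `]u i, v i[%classic) ->
  exists2 s, admissible a b s & forall F : R * R -> R, (forall x, F (x, x) = 0) ->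
    \sum_(x <- s) F x = \sum_(i < n) F (u i, v i).
Proof.
move=> uv tuv; exists [seq (u i, v i) | i <- enum 'I_n & u i < v i]; last first.
  move=> F F0; rewrite big_map big_filter big_enum_cond/= big_mkcond/=.
  apply: eq_bigr => i _; case: ltP => // vu.
  by have [_ [uvi _]] := uv i; rewrite (_ : v i = u i) ?F0//; apply/le_anti; rewrite vu uvi.
apply/andP; split.
  rewrite all_map; apply/allP => i _ /=.
  by have [-> [-> ->]] := uv i.
rewrite pairwise_map.
have : pairwise [rel x y | x != y] [seq i <- enum 'I_n | u i < v i].
  by rewrite -uniq_pairwise filter_uniq// enum_uniq.
apply: (@sub_in_pairwise _ [pred i | u i < v i]); last exact: filter_all.
move=> i j; rewrite !inE /= => ui uj; apply: contra_neqT;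
  rewrite /separated/= negb_or -!ltNge.
move=> /andP[uvji uvij].
(* Two nondegenerate segments that are not separated overlap, and the midpoint of the overlap is a
   common interior point. *)
apply: tuv => //; exists ((Num.max (u i) (u j) + Num.min (v i) (v j)) / 2).
have mm : Num.max (u i) (u j) < Num.min (v i) (v j).
  by rewrite gt_max !lt_min ui uj uvji uvij.
have h1 : Num.max (u i) (u j) < (Num.max (u i) (u j) + Num.min (v i) (v j)) / 2 by lra.
have h2 : (Num.max (u i) (u j) + Num.min (v i) (v j)) / 2 < Num.min (v i) (v j) by lra.
move: h1 h2; set w := (_ / 2); rewrite gt_max lt_min => /andP[i1 j1] /andP[i2 j2].
by split; rewrite /= in_itv/= ?i1 ?i2 ?j1 ?j2.
Qed.

(** Let [d] be the modulus for tolerance 1. Any piece shorter than [d] has variation at most 1, and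
    finitely many pieces of length [d / 2] cover the segment. *)
Lemma absolutely_continuous_BV a b f : a < b -> absolutely_continuous_on a b f ->
  bounded_variation a b f.
Proof.
move=> ab acf; have [d d0 H] := absolutely_continuous_seq acf ltr01.
have step u v : a <= u -> u <= v -> v <= b -> v - u < d ->
    (total_variation u v f <= 1%:E)%E.
  move=> au uv vb uvd.
  have H1 s : admissible a b s -> \sum_(x <- s) (x.2 - x.1) < d ->
      \sum_(x <- s) `|f x.2 - f x.1| <= 1 by move=> As sd; exact/ltW/H.
  have A1 : admissible a b ([:: (u, v)] ++ [::]) by rewrite /admissible /= au uv vb.
  have := total_variation_seq H1 A1; rewrite big_cons big_nil addr0 => /(_ uvd).
  by rewrite big_cons !big_nil !adde0.
have ind n v : a <= v -> v <= b -> v - a <= n%:R * (d / 2) ->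
    (total_variation a v f <= n%:R%:E)%E.
  elim: n v => [v av vb|n ih v av vb].
    rewrite mul0r subr_le0 => va; rewrite (_ : v = a) ?total_variationxx//.
    by apply/le_anti; rewrite va av.
  rewrite -natr1 mulrDl mul1r => vn.
  have d2 : d / 2 < d by rewrite ltr_pdivrMr// ltr_pMr// ltr1n.
  have d20 : 0 < d / 2 by rewrite divr_gt0.
  have [va|va] := leP (v - d / 2) a.
    apply: (le_trans (step _ _ _ _ _ _)) => //; last by rewrite lee_fin lerDr.
    by rewrite (le_lt_trans _ d2)// lerBlDr addrC -lerBlDr.
  rewrite (total_variationD _ (ltW va)) ?lerBlDr ?lerDl ?(ltW d20)//.
  rewrite EFinD; apply: leeD.
    apply: ih; first exact: ltW.
      by rewrite (le_trans _ vb)// lerBlDr lerDl ltW.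
    by rewrite addrAC lerBlDr.
  by apply: step; rewrite ?(ltW va) ?lerBlDr ?lerDl ?(ltW d20)// opprB subrKC.
apply/(bounded_variationP f (ltW ab)).
rewrite ge0_fin_numE ?total_variation_ge0 ?ltW//.
have d20 : 0 < d / 2 by rewrite divr_gt0.
apply: (le_lt_trans (ind (Num.truncn ((b - a) / (d / 2))).+1 b (ltW ab) (lexx _) _));
  last exact: ltry.
by rewrite -ler_pdivrMr//; apply/ltW; rewrite truncnS_gt// divr_ge0 ?subr_ge0 ?ltW.
Qed.

Lemma absolutely_continuous_total_variation a b f : a < b ->
  absolutely_continuous_on a b f ->
  absolutely_continuous_on a b (fun x => fine (total_variation a x f)).
Proof.
move=> ab acf; have bvf := absolutely_continuous_BV ab acf.
move=> e e0; have e2 : 0 < e / 2 by rewrite divr_gt0.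
have [d d0 H] := absolutely_continuous_seq acf e2; exists d => // n u v uv tuv uvd.
have TVfin x y : a <= x -> x <= y -> y <= b -> total_variation x y f \is a fin_num.
  move=> ax xy yb; apply/(bounded_variationP _ xy).
  by apply: (bounded_variationr ax xy); apply: bounded_variationl bvf => //;
    exact: le_trans xy.
have [s As sE] := admissible_ord uv tuv.
have TVE i : `|fine (total_variation a (v i) f) - fine (total_variation a (u i) f)| =
    fine (total_variation (u i) (v i) f).
  have [au [uvi vb]] := uv i.
  rewrite (total_variationD _ au uvi) fineD ?TVfin ?(le_trans uvi)//.
  by rewrite addrC addKr ger0_norm// fine_ge0// total_variation_ge0.
under eq_bigr do rewrite TVE.
rewrite -(sE (fun x => fine (total_variation x.1 x.2 f))); last first.
  by move=> x; rewrite total_variationxx.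
have := @total_variation_seq _ a b f d (e / 2) _ s [::].
rewrite cats0 big_nil adde0 => /(_ _ As) /=.
rewrite (sE (fun x => x.2 - x.1)) => [|x]; last by rewrite /= subrr.
move=> /(_ _ uvd) Hs.
apply: (@le_lt_trans _ _ (e / 2)); last by rewrite ltr_pdivrMr// ltr_pMr// ltr1n.
rewrite -lee_fin -sumEFin; apply: le_trans (Hs _); last by move=> t At td; exact/ltW/H.
rewrite le_eqVlt; apply/orP; left; apply/eqP.
rewrite big_seq [RHS]big_seq; apply: eq_bigr => x xs; rewrite fineK//.
by move: As => /andP[/allP/(_ _ xs)/and3P[ax xx xb] _]; exact: TVfin.
Qed.

(** Jordan decomposition: [f] is the variation function minus a nondecreasing remainder, and each
    has a density. Near an interior point [f] is a constant plus the indefinite integral of the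
    difference of the densities, so Lebesgue differentiation gives the derivative. *)
Lemma absolutely_continuous_density a b f : a < b -> absolutely_continuous_on a b f ->
  exists g : R -> R, [/\ lebesgue_measure.-integrable setT (EFin \o g),
    forall x, a <= x -> x <= b -> f x - f a = \int[lebesgue_measure]_(t in `]a, x]) g t &
    {ae lebesgue_measure, forall x, a < x -> x < b -> is_derive x 1 f (g x)}].
Proof.
move=> ab acf; have bvf := absolutely_continuous_BV ab acf.
have acV := absolutely_continuous_total_variation ab acf.
pose V x := fine (total_variation a x f).
pose clamp (x : R) := Num.max a (Num.min b x).
have clampE x : a <= x -> x <= b -> clamp x = x.
  by move=> ax xb; rewrite /clamp (min_idPr xb) (max_idPr ax).
have clampa x : x <= a -> clamp x = a.
  by move=> xa; rewrite /clamp (min_idPr (le_trans xa (ltW ab))) (max_idPl xa).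
have clampb x : b <= x -> clamp x = b.
  by move=> bx; rewrite /clamp (min_idPl bx) (max_idPr (ltW ab)).
have clampP x y : x <= y -> [&& a <= clamp x, clamp x <= clamp y & clamp y <= b].
  move=> xy; rewrite /clamp; apply/and3P; split; first by rewrite le_max lexx.
    by rewrite ge_max !le_max lexx/= le_min !ge_min xy lexx !orbT.
  by rewrite ge_max (ltW ab) ge_min lexx.
have TVfin x y : a <= x -> x <= y -> y <= b -> total_variation x y f \is a fin_num.
  move=> ax xy yb; apply/(bounded_variationP _ xy).
  by apply: (bounded_variationr ax xy); apply: bounded_variationl bvf => //;
    exact: le_trans xy.
have VB x y : a <= x -> x <= y -> y <= b -> `|f y - f x| <= V y - V x.
  move=> ax xy yb; rewrite /V (total_variationD _ ax xy) fineD ?TVfin ?(le_trans xy)//.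
  by rewrite [leRHS]addrC addKr -lee_fin fineK ?TVfin// total_variation_ge.
(* The two Jordan components, continued by constants so that they define measures on the whole
   line. *)
pose P x := V (clamp x); pose Q x := V (clamp x) - f (clamp x).
have [gP iP EP] : exists2 g : R -> R, lebesgue_measure.-integrable setT (EFin \o g) &
  forall x, a <= x -> x <= b -> P x - P a = \int[lebesgue_measure]_(t in `]a, x]) g t.
  apply: (nondecreasing_density ab).
  - move=> x y xy; have /and3P[ax' xy' yb'] := clampP _ _ xy.
    by rewrite -subr_ge0 (le_trans _ (VB _ _ ax' xy' yb')).
  - by move=> x xa; rewrite /P !clampa.
  - by move=> x bx; rewrite /P !clampb.
  move=> e e0; have [d d0 H] := acV e e0; exists d => // n u v uv tuv uvd.
  rewrite (eq_bigr (fun i => `|V (v i) - V (u i)|)); first exact: H.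
  move=> i _; have [au [uvi vb]] := uv i.
  by rewrite /P !clampE// ?(le_trans au) ?(le_trans uvi).
have [gQ iQ EQ] : exists2 g : R -> R, lebesgue_measure.-integrable setT (EFin \o g) &
  forall x, a <= x -> x <= b -> Q x - Q a = \int[lebesgue_measure]_(t in `]a, x]) g t.
  apply: (nondecreasing_density ab).
  - move=> x y xy; have /and3P[ax' xy' yb'] := clampP _ _ xy.
    by have := VB _ _ ax' xy' yb'; rewrite /Q ler_norml => /andP[_]; lra.
  - by move=> x xa; rewrite /Q !clampa.
  - by move=> x bx; rewrite /Q !clampb.
  (* An increment of [Q] is at most twice that of [V], hence the half. *)
  move=> e e0; have e2 : 0 < e / 2 by rewrite divr_gt0.
  have [d d0 H] := acV _ e2; exists d => // n u v uv tuv uvd.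
  have := H _ _ _ uv tuv uvd; rewrite ltr_pdivlMr// mulr_suml => Hlt;
    apply: le_lt_trans Hlt.
  apply: ler_sum => i _; have [au [uvi vb]] := uv i.
  rewrite /Q !clampE ?(le_trans uvi vb) ?(le_trans au uvi)//.
  have := VB _ _ au uvi vb; rewrite -/(V (v i)) -/(V (u i)) => VBi.
  rewrite (_ : V (v i) - f (v i) - (V (u i) - f (u i)) = (V (v i) - V (u i)) - (f (v i) -
    f (u i))); last by ring.
  by rewrite mulr_natr mulr2n (le_trans (ler_normB _ _))// lerD2l (le_trans VBi)// ler_norm.
exists (gP \- gQ); split.
- rewrite (_ : EFin \o _ = (EFin \o gP) \- (EFin \o gQ))%E; last by apply/funext.
  exact: integrableB.
- move=> x ax xb; rewrite RintegralB//; last 2 first.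
  + exact: integrableS iP.
  + exact: integrableS iQ.
  by rewrite -EP// -EQ// /P /Q !clampE ?(ltW ab)//; lra.
have ig : lebesgue_measure.-integrable setT (EFin \o (gP \- gQ)).
  rewrite (_ : EFin \o _ = (EFin \o gP) \- (EFin \o gQ))%E; last by apply/funext.
  exact: integrableB.
have igy y : lebesgue_measure.-integrable [set` Interval (BRight a) (BRight y)] (EFin \o
  (gP \- gQ)).
  by apply: integrableS ig => //; exact: measurable_itv.
have := FTC1 igy (open_integrable_locally openT ig).
apply: filterS; first exact: (ae_filter_ringOfSetsType lebesgue_measure).
move=> x /= H ax xb.
have /H[dF F'] : (BRight a < BRight x)%O by rewrite bnd_simp.
apply: (@near_eq_is_derive _ _ _
  (fun y => f a + \int[lebesgue_measure]_(t in `]a, y]) (gP \- gQ) t)).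
  near=> y; have ay : a <= y by apply/ltW; near: y; exact: lt_nbhsr.
  have yb : y <= b by apply/ltW; near: y; exact: lt_nbhsl.
  rewrite RintegralB//; last 2 first.
  + exact: integrableS iP.
  + exact: integrableS iQ.
  by rewrite -EP// -EQ// /P /Q !clampE ?(ltW ab)//; lra.
rewrite -[X in is_derive _ _ _ X]add0r -F' derive1E.
by apply: is_deriveD; apply: DeriveDef.
Unshelve. all: by end_near. Qed.

End Density.

(** * Integration, derivatives and powers *)

Section Integration.
Context {R : realType}.
Implicit Types (a b : R) (f F : R -> R).
Local Notation mu := (@lebesgue_measure R).

(* [C] need not be measurable. *)
Lemma le_integral_minorant (D : set R) (r : R -> R) (C : R -> \bar R) :
  measurable D -> measurable_fun D r -> (forall x, D x -> 0 <= r x) ->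
  (forall x, D x -> (0 <= C x)%E) ->
  {ae mu, forall x, D x -> ((r x)%:E <= C x)%E} ->
  (\int[mu]_(x in D) (r x)%:E <= \int[mu]_(x in D) C x)%E.
Proof.
move=> mD mr r0 C0 [N [mN N0 sub]].
have mre := (measurable_EFinP D r).2 mr.
(* The exceptional null set is removed from the left integral only. Integrals of nonnegative
   functions being suprema over simple functions, it remains to see that each simple function below
   the restricted [r] is below [C]. *)
rewrite (@ge0_negligible_integral _ _ _ mu D N (EFin \o r))//.
rewrite integral_mkcond [leRHS]integral_mkcond !ge0_integralTE; last 2 first.
- by apply: erestrict_ge0.
- by apply: erestrict_ge0 => x [Dx _]; rewrite lee_fin r0.
apply: ereal_sup_le => _ [h hr <-]; exists h => // x.
apply: le_trans (hr x) _; rewrite /patch.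
case: ifPn => [|_]; last by case: ifPn => // /[!inE] /C0.
rewrite inE => -[Dx Nx]; rewrite ifT ?inE//=.
by apply: contrapT => H; apply: Nx; apply: sub => /= /(_ Dx).
Qed.

Lemma is_derive_MVT F f a b : a < b ->
  (forall s, a <= s -> s <= b -> is_derive s 1 F (f s)) ->
  exists2 c, a < c < b & F b - F a = f c * (b - a).
Proof.
move=> ab dF; have [||c cab E] := @MVT R F f a b ab.
- by move=> s; rewrite in_itv/= => /andP[/ltW as_ /ltW sb]; exact: dF.
- apply: derivable_within_continuous => s; rewrite in_itv/= => /andP[as_ sb].
  exact/ex_derive/dF.
by exists c.
Qed.

Lemma is_derive_lipschitz F f a b (M : R) :
  (forall s, a <= s -> s <= b -> is_derive s 1 F (f s)) ->
  (forall s, a <= s -> s <= b -> `|f s| <= M) ->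
  forall u v, a <= u -> u <= v -> v <= b -> `|F v - F u| <= M * (v - u).
Proof.
move=> dF fM u v au; rewrite le_eqVlt => /predU1P[<-|uv vb];
  first by rewrite !subrr normr0 mulr0.
have [s us sv|c /andP[uc cv] ->] := @is_derive_MVT F f u v uv.
  by apply: dF; [exact: le_trans us|exact: le_trans vb].
have vu : 0 < v - u by rewrite subr_gt0.
rewrite normrM (ger0_norm (ltW vu)) ler_pM2r//.
by apply: fM; apply/ltW; [exact: le_lt_trans uc|exact: lt_le_trans vb].
Qed.

Lemma lipschitz_absolutely_continuous a b f (M : R) :
  (forall u v, a <= u -> u <= v -> v <= b -> `|f v - f u| <= M * (v - u)) ->
  absolutely_continuous_on a b f.
Proof.
move=> H e e0; exists (e / (`|M| + 1)); first by rewrite divr_gt0// ltr_wpDl.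
move=> n u v uv _; rewrite ltr_pdivlMr ?ltr_wpDl// => uvd; apply: le_lt_trans uvd.
rewrite mulr_suml; apply: ler_sum => i _; have [au [uvi vb]] := uv i.
rewrite (le_trans (H _ _ au uvi vb))// mulrC ler_wpM2l ?subr_ge0//.
by rewrite (le_trans (ler_norm _))// lerDl.
Qed.

Lemma continuous_segment_integrable a b f :
  (forall s, a <= s -> s <= b -> {for s, continuous f}) ->
  mu.-integrable `[a, b] (EFin \o f).
Proof.
move=> cf; apply: continuous_compact_integrable; first exact: segment_compact.
by apply: continuous_in_subspaceT => s; rewrite inE/= in_itv/= => /andP[]; exact: cf.
Qed.

Lemma is_derive_Rintegral F f a b : a <= b ->
  (forall s, a <= s -> s <= b -> is_derive s 1 F (f s)) ->
  (forall s, a <= s -> s <= b -> {for s, continuous f}) ->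
  \int[mu]_(s in `[a, b]) f s = F b - F a.
Proof.
rewrite le_eqVlt => /predU1P[<- _ _|ab dF cf].
  by rewrite set_itv1 Rintegral_set1 subrr.
have cF s : a <= s -> s <= b -> {for s, continuous F}.
  move=> as_ sb; apply: differentiable_continuous; apply/derivable1_diffP.
  exact/ex_derive/dF.
rewrite /Rintegral (@continuous_FTC2 _ f F)//.
- by apply: continuous_in_subspaceT => s; rewrite inE/= in_itv/= => /andP[]; exact: cf.
- split.
  + by move=> s; rewrite in_itv/= => /andP[/ltW as_ /ltW sb]; exact/ex_derive/dF.
  + by apply: cvg_at_right_filter; apply: cF => //; exact: ltW.
  + by apply: cvg_at_left_filter; apply: cF => //; exact: ltW.
- move=> s; rewrite in_itv/= => /andP[/ltW as_ /ltW sb].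
  by rewrite derive1E; apply: derive_val; exact: dF.
Qed.

End Integration.

Section RealDerivatives.
Context {R : realType}.
Implicit Types (f g : R -> R) (a b c x : R).

Lemma is_derive_addf f g x a b : is_derive x 1 f a -> is_derive x 1 g b ->
  is_derive x 1 (fun y => f y + g y) (a + b).
Proof. exact: is_deriveD. Qed.

Lemma is_derive_mulf f g x a b : is_derive x 1 f a -> is_derive x 1 g b ->
  is_derive x 1 (fun y => f y * g y) (f x * b + g x * a).
Proof. exact: is_deriveM. Qed.

Lemma is_derive_scalef f c x a : is_derive x 1 f a ->
  is_derive x 1 (fun y => c * f y) (c * a).
Proof. exact: is_deriveZ. Qed.

Lemma is_derive_oppf f x a : is_derive x 1 f a -> is_derive x 1 (fun y => - f y) (- a).
Proof. exact: is_deriveN. Qed.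

Lemma is_derive_shiftf f c x a : is_derive x 1 f a ->
  is_derive x 1 (fun y => c + f y) a.
Proof.
by move=> fa; rewrite -[a]add0r; apply: is_derive_addf => //; exact: is_derive_cst.
Qed.

Lemma is_derive_compf f g x a b : is_derive (g x) 1 f a -> is_derive x 1 g b ->
  is_derive x 1 (fun y => f (g y)) (a * b).
Proof. exact: is_derive1_comp. Qed.

Lemma is_derive_affine c k x : is_derive x 1 (fun y => c + k * y) k.
Proof.
apply: is_derive_shiftf; rewrite -[X in is_derive _ _ _ X]mulr1.
by apply: is_derive_scalef; exact: is_derive_id.
Qed.

Lemma is_derive_translate f c x a : is_derive (x - c) 1 f a ->
  is_derive x 1 (fun y => f (y - c)) a.
Proof.
move=> fa; have sh : is_derive x 1 (fun y => y - c) 1.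
  by have := is_derive_affine (- c) 1 x; congr is_derive; apply/funext => y;
    rewrite mul1r addrC.
by have := @is_derive_compf f (fun y => y - c) x a 1 fa sh; rewrite mulr1.
Qed.

Lemma is_derive_reflect f c x a : is_derive (c - x) 1 f a ->
  is_derive x 1 (fun y => f (c - y)) (- a).
Proof.
move=> fa; have sh : is_derive x 1 (fun y => c - y) (-1).
  by have := is_derive_affine c (-1) x; congr is_derive; apply/funext => y; rewrite mulN1r.
by have := @is_derive_compf f (fun y => c - y) x a (-1) fa sh; rewrite mulrN1.
Qed.

Lemma is_derive_continuous f x a : is_derive x 1 f a -> {for x, continuous f}.
Proof. by move=> fa; apply/differentiable_continuous/derivable1_diffP/ex_derive. Qed.

End RealDerivatives.

Section Powers.
Context {R : realType}.
Implicit Types (u v x y : R).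

(* Strict weighted AM-GM, from [1 + x < exp x] applied to [ln (y / m)] and
   [ln (1 / m)], with [m] the arithmetic mean. *)
Lemma powR_lt_mean (c y : R) : 0 < c < 1 -> 0 <= y -> y != 1 ->
  y `^ c < 1 + c * (y - 1).
Proof.
move=> /andP[c0 c1]; rewrite le_eqVlt => /predU1P[<- _|y0 y1].
  by rewrite powR0 ?gt_eqF//; lra.
set m := 1 + c * (y - 1).
have m0 : 0 < m.
  rewrite /m (_ : _ + _ = (1 - c) + c * y); last by ring.
  by rewrite addr_gt0 ?subr_gt0// mulr_gt0.
have ym : y / m != 1.
  apply: contra_neq y1 => /(congr1 ( *%R^~ m)); rewrite divfK ?gt_eqF// mul1r => yE.
  have : (1 - c) * (y - 1) = 0.
    by have : y - m = 0; [rewrite -yE subrr|rewrite /m => <-; ring].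
  by move=> /eqP; rewrite mulf_eq0 !subr_eq0 [1 == c]gt_eqF//= => /eqP.
have h1 : 1 + (ln y - ln m) < y / m.
  rewrite -ln_div ?posrE// -[ltRHS]lnK ?posrE ?divr_gt0//.
  by apply: expR_gt1Dx; rewrite ln_eq0 ?divr_gt0.
have h2 : 1 - ln m <= m^-1.
  rewrite -lnV ?posrE// -[leRHS]lnK ?posrE ?invr_gt0//.
  exact: expR_ge1Dx.
have h3 : c * (1 + (ln y - ln m)) + (1 - c) * (1 - ln m) < 1.
  have E : c * (y / m) + (1 - c) * m^-1 = 1.
    have -> : c * (y / m) + (1 - c) * m^-1 = m / m by rewrite /m; ring.
    by rewrite divff ?gt_eqF.
  rewrite -[ltRHS]E.
  by apply: ltr_leD; [rewrite ltr_pM2l|rewrite ler_pM2l ?subr_gt0].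
rewrite /powR gt_eqF// -[ltRHS]lnK ?posrE// ltr_expR.
by clearbody m; lra.
Qed.

(** This is [powR_lt_mean] with exponent [al^-1] at the point u^al, solved for u^al. *)
Lemma bernoulli_powR (al u : R) : 1 < al -> 0 <= u -> u != 1 ->
  1 + al * (u - 1) < u `^ al.
Proof.
move=> al1 u0 u1; have al0 : 0 < al by exact: lt_trans al1.
have := @powR_lt_mean al^-1 (u `^ al);
  rewrite invr_gt0 al0 invf_lt1// al1 powR_ge0 => /(_ isT isT).
rewrite -powRrM divff ?(lt0r_neq0 al0)// powRr1//.
have -> : u `^ al != 1.
  by rewrite powR_eq1 !negb_or u1 -leNgt u0 gt_eqF.
move=> /(_ isT) h.
have : al * u < al * (1 + al^-1 * (u `^ al - 1)) by rewrite ltr_pM2l.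
by rewrite mulrDr mulrA divff ?gt_eqF// mul1r; lra.
Qed.

(** By homogeneity this is Bernoulli's inequality at [v / a]; only a = 0 is separate. *)
Lemma powR_gt_tangent (al a v : R) : 1 < al -> 0 <= a -> 0 <= v -> v != a ->
  a `^ al + al * a `^ (al - 1) * (v - a) < v `^ al.
Proof.
move=> al1; have al0 : 0 < al by exact: lt_trans al1.
rewrite le_eqVlt => /predU1P[<- v0 va|a0 v0 va].
  rewrite !powR0 ?gt_eqF ?subr_gt0// mulr0 mul0r addr0 powR_gt0//.
  by rewrite lt_neqAle eq_sym va.
have := @bernoulli_powR al (v / a) al1; rewrite divr_ge0 ?(ltW a0)// => /(_ isT).
have -> : v / a != 1.
  by apply: contra_neq va => /(congr1 ( *%R^~ a)); rewrite divfK ?gt_eqF// mul1r.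
move=> /(_ isT); rewrite -(ltr_pM2r (powR_gt0 al a0)) -powRM ?divr_ge0 ?(ltW a0)//.
rewrite divfK ?gt_eqF//; apply: le_lt_trans.
rewrite -(mulr_powRB1 (ltW a0) al0) le_eqVlt; apply/orP; left; apply/eqP.
by field; rewrite gt_eqF.
Qed.

Lemma powR_ge_tangent (al a v : R) : 1 < al -> 0 <= a -> 0 <= v ->
  a `^ al + al * a `^ (al - 1) * (v - a) <= v `^ al.
Proof.
move=> al1 a0 v0; have [->|va] := eqVneq v a; first by rewrite subrr mulr0 addr0.
exact/ltW/powR_gt_tangent.
Qed.

End Powers.

(** * Optimal plans *)

Lemma ae_neq (R : realType) (a : R) : {ae @lebesgue_measure R, forall x, x != a}.
Proof.
exists [set a]; split; [exact: measurable_set1|exact: lebesgue_measure_set1|].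
by move=> x /= /negP; rewrite negbK => /eqP.
Qed.

Section Optimum.
Context {R : realType}.
Variables (alpha lambda mu : R).
Hypotheses (halpha : 1 < alpha) (hlambda : 0 < lambda) (hmu : 0 < mu).
Local Notation leb := (@lebesgue_measure R).
Implicit Types r s t u x y : R.

(** Equal discounted marginal costs, (1 + lambda r)^(- mu / lambda) v^(alpha - 1) = const, force a
    speed v proportional to (1 + lambda r)^(mu / (lambda (alpha - 1))). The primitive of that speed
    has the exponent [expo]. *)
Definition expo : R := mu / (lambda * (alpha - 1)) + 1.

(* [effort u] is the integral of [(1 + lambda r) `^ (expo - 1)] over [0, u]; an
   optimal plan over a remaining time [u] moves at a speed proportional to the
   integrand. *)
Definition effort (u : R) : R := ((1 + lambda * u) `^ expo - 1) / (lambda * expo).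

Let a1 : 0 < alpha - 1. Proof. by rewrite subr_gt0. Qed.
Let al0 : 0 < alpha. Proof. exact: lt_trans halpha. Qed.

Lemma expo_gt1 : 1 < expo.
Proof. by rewrite /expo ltrDr divr_gt0// mulr_gt0. Qed.

Lemma expoE : mu / lambda = (alpha - 1) * (expo - 1).
Proof. by rewrite /expo addrK; field; rewrite !gt_eqF. Qed.

Let p0 : 0 < expo. Proof. exact: lt_trans expo_gt1. Qed.
Let lp0 : 0 < lambda * expo. Proof. by rewrite mulr_gt0. Qed.

Lemma effort0 : effort 0 = 0.
Proof. by rewrite /effort mulr0 addr0 powR1 subrr mul0r. Qed.

Lemma base_gt0 u : 0 <= u -> 0 < 1 + lambda * u.
Proof. by move=> u0; rewrite ltr_pwDl// mulr_ge0// ltW. Qed.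

Lemma base_ge1 u : 0 <= u -> 1 <= 1 + lambda * u.
Proof. by move=> u0; rewrite lerDl mulr_ge0// ltW. Qed.

Lemma base_gt1 u : 0 < u -> 1 < 1 + lambda * u.
Proof. by move=> u0; rewrite ltrDl mulr_gt0. Qed.

Lemma powR_gt1 (x r : R) : 1 < x -> 0 < r -> 1 < x `^ r.
Proof.
move=> x1 r0; rewrite (_ : 1 = 1 `^ r); last by rewrite powR1.
by rewrite gt0_ltr_powR// ?nnegrE// ltW// (lt_trans ltr01).
Qed.

Lemma effort_gt0 u : 0 < u -> 0 < effort u.
Proof. by move=> u0; rewrite divr_gt0// subr_gt0 powR_gt1// base_gt1. Qed.

Lemma effort_ge0 u : 0 <= u -> 0 <= effort u.
Proof. by rewrite le_eqVlt => /predU1P[<-|/effort_gt0/ltW//]; rewrite effort0. Qed.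

Lemma is_derive_base_powR r u : 0 < 1 + lambda * u ->
  is_derive u 1 (fun u => (1 + lambda * u) `^ r) (lambda * r * (1 + lambda * u) `^ (r - 1)).
Proof.
move=> u0.
have := @is_derive_compf _ (fun x => x `^ r) (fun u => 1 + lambda * u) u _ _
  (is_derive1_powR r u0) (is_derive_affine 1 lambda u).
by move/is_derive_eq; apply; ring.
Qed.

Lemma is_derive_effort u : 0 <= u -> is_derive u 1 effort ((1 + lambda * u) `^ (expo - 1)).
Proof.
move=> u0; have d1 := is_derive_base_powR expo (base_gt0 u0).
have := is_derive_scalef (lambda * expo)^-1 (is_derive_shiftf (-1) d1).
rewrite mulrA mulVf ?(lt0r_neq0 lp0)// mul1r.
by congr is_derive; apply/funext => v; rewrite /effort mulrC addrC.
Qed.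

Section SingleGoal.
Variables (T t D : R).
Hypotheses (tT : t < T) (D0 : 0 <= D).

Let q : R := D / effort (T - t).
Let v s : R := q * (1 + lambda * (s - t)) `^ (expo - 1).

Definition optimal_plan (x s : R) : R := x + D / effort (T - t) * effort (s - t).

(* Along [optimal_plan] the marginal discounted cost of speed is the constant
   [alpha * price]. *)
Definition price : R := (D / effort (T - t)) `^ (alpha - 1).

Let I0 : 0 < effort (T - t). Proof. by rewrite effort_gt0// subr_gt0. Qed.
Let q0 : 0 <= q. Proof. by rewrite divr_ge0// ltW. Qed.
Let b0 s : t <= s -> 0 < 1 + lambda * (s - t).
Proof. by move=> ts; rewrite base_gt0// subr_ge0. Qed.
Let v0 s : 0 <= v s. Proof. by rewrite mulr_ge0// powR_ge0. Qed.
Let price0 : 0 <= price. Proof. exact: powR_ge0. Qed.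

Lemma is_derive_optimal_plan x s : t <= s ->
  is_derive s 1 (optimal_plan x) (q * (1 + lambda * (s - t)) `^ (expo - 1)).
Proof.
move=> ts; apply: is_derive_shiftf; apply: is_derive_scalef.
have st : 0 <= s - t by rewrite subr_ge0.
by apply: is_derive_translate; exact: is_derive_effort.
Qed.

Lemma optimal_plan_start x : optimal_plan x t = x.
Proof. by rewrite /optimal_plan subrr effort0 mulr0 addr0. Qed.

Lemma optimal_plan_end x : optimal_plan x T = x + D.
Proof. by rewrite /optimal_plan divfK ?gt_eqF. Qed.

Let cv s : t <= s -> {for s, continuous v}.
Proof.
move=> ts; have st : 0 <= s - t by rewrite subr_ge0.
have := is_derive_scalef q (is_derive_translate (is_derive_base_powR (expo - 1) (base_gt0
  st))).
exact: is_derive_continuous.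
Qed.

Let int_v s : t <= s -> \int[leb]_(r in `[t, s]) v r = q * effort (s - t).
Proof.
move=> ts.
have dv r : t <= r -> r <= s -> is_derive r 1 (optimal_plan 0) (v r).
  by move=> tr _; exact: is_derive_optimal_plan.
have cvr r : t <= r -> r <= s -> {for r, continuous v} by move=> tr _; exact: cv.
rewrite (is_derive_Rintegral ts dv cvr).
by rewrite optimal_plan_start subr0 /optimal_plan add0r.
Qed.

Let v_int s : leb.-integrable `[t, s] (EFin \o v).
Proof. by apply: continuous_segment_integrable => r tr _; exact: cv. Qed.

Lemma optimal_plan_AC x : absolutely_continuous_on t T (optimal_plan x).
Proof.
apply: (@lipschitz_absolutely_continuous _ _ _ _ (v T)).
apply: (@is_derive_lipschitz _ _ v t T) => [s ts sT|s ts sT];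
  first exact: is_derive_optimal_plan.
rewrite ger0_norm ?v0// ler_wpM2l// ge0_ler_powR ?nnegrE ?subr_ge0 ?(ltW expo_gt1)//.
- exact/ltW/b0.
- exact/ltW/b0/ltW.
- by rewrite lerD2l ler_wpM2l ?(ltW hlambda)// lerD2r.
Qed.

Let gam s : R := discount lambda mu t s.

Let gam_gt0 s : t <= s -> 0 < gam s.
Proof. by move=> ts; rewrite powR_gt0// b0. Qed.

Let gam_v s : t <= s -> gam s * v s `^ (alpha - 1) = price.
Proof.
move=> ts; rewrite /gam /discount /v /price -/q powRM// ?powR_ge0//.
rewrite mulrCA -powRrM [(expo - 1) * _]mulrC -expoE -powRD ?addNr ?powRr0 ?mulr1//.
by rewrite eqxx gt_eqF ?b0.
Qed.

Let gam_v_alpha s : t <= s -> gam s * v s `^ alpha = price * v s.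
Proof. by move=> ts; rewrite -mulr_powRB1// mulrCA gam_v// mulrC. Qed.

Definition plan_cost (z : R -> R) : \bar R :=
  (\int[leb]_(s in `[t, T]) ((discount lambda mu t s)%:E * cost alpha (derive1 z s)))%E.

Lemma plan_cost_ge0 z : (0 <= plan_cost z)%E.
Proof.
apply: integral_ge0 => s _; rewrite mule_ge0 ?lee_fin ?powR_ge0// /cost.
by case: ifP => _; rewrite ?leey// lee_fin powR_ge0.
Qed.

Lemma plan_cost_optimal x : plan_cost (optimal_plan x) = (price * D)%:E.
Proof.
have -> : plan_cost (optimal_plan x) = (\int[leb]_(s in `[t, T]) (price * v s)%:E)%E.
  apply: eq_integral => s; rewrite inE/= in_itv/= => /andP[ts _].
  have -> : derive1 (optimal_plan x) s = v s.
    by rewrite derive1E; apply: derive_val; exact: is_derive_optimal_plan.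
  by rewrite /cost v0 -EFinM -/(gam s) gam_v_alpha.
rewrite -[LHS]fineK; last first.
  apply: integrable_fin_num => //; apply: continuous_segment_integrable => s ts _.
  by apply: continuousM; [exact: cvg_cst|exact: cv].
congr EFin; rewrite -[LHS]/(\int[leb]_(s in `[t, T]) (price * v s)).
by rewrite RintegralZl// int_v ?(ltW tT)// divfK ?gt_eqF.
Qed.

Section Competitor.
Variables (z g : R -> R).
Hypotheses (ig : leb.-integrable setT (EFin \o g))
  (zg : forall s, t <= s -> s <= T -> z s - z t = \int[leb]_(r in `]t, s]) g r)
  (dz : {ae leb, forall s, t < s -> s < T -> is_derive s 1 z (g s)})
  (zD : 0 < D -> D <= z T - z t).

(* A real-valued minorant of the discounted cost (up to a null set): the penalty
   [- g] stands for the infinite cost of moving backwards. *)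
Let r s : R := gam s * Num.max (g s) 0 `^ alpha + Num.max (- g s) 0.

(** The discounted cost linearised at the optimal speed [v s]. The coefficient of [g s] is the same
    for all [s], so the competitor enters the integral only through its displacement. *)
Let h s : R := (price - alpha * price) * v s + alpha * price * g s.

Let r_ge0 s : 0 <= r s.
Proof. by rewrite addr_ge0 ?mulr_ge0 ?powR_ge0// le_max lexx orbT. Qed.

Let h_lt_r s : t <= s -> g s != v s -> h s < r s.
Proof.
move=> ts gv; rewrite /h /r.
have G := gam_gt0 ts.
have H y : gam s * (v s `^ alpha + alpha * v s `^ (alpha - 1) * (y - v s)) =
    (price - alpha * price) * v s + alpha * price * y.
  rewrite mulrDr gam_v_alpha// mulrA [gam s * _]mulrCA gam_v//; ring.
case: (leP 0 (g s)) => g0.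
  rewrite (max_idPr _) ?oppr_le0// addr0 -H ltr_pM2l//.
  exact: powR_gt_tangent.
rewrite (max_idPl _) ?oppr_ge0 ?(ltW g0)//.
(* For a backward speed, the nondecreasing tangent line lies below its value at speed 0, and the
   penalty [- g s > 0] makes the inequality strict. *)
have : h s <= gam s * 0 `^ alpha.
  apply: (@le_trans _ _ ((price - alpha * price) * v s + alpha * price * 0)).
    by rewrite lerD2l ler_wpM2l ?mulr_ge0 ?(ltW al0)// ltW.
  by rewrite -H ler_pM2l// powR_ge_tangent.
by rewrite /h; lra.
Qed.

Let h_le_r s : t <= s -> h s <= r s.
Proof.
move=> ts; have [gv|/(h_lt_r ts)/ltW//] := eqVneq (g s) (v s).
rewrite /h /r gv (max_idPl (v0 s)) (max_idPr _) ?oppr_le0// addr0 gam_v_alpha//.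
by rewrite -mulrDl subrK.
Qed.

Let mg : measurable_fun setT g.
Proof. by move/integrableP : ig => [/measurable_EFinP]. Qed.

Let mr : measurable_fun `[t, T]%classic r.
Proof.
apply: (@measurable_funS _ _ _ _ setT) => //.
apply: measurable_funD; last by apply: measurable_maxr => //; exact: measurable_funN.
apply: measurable_funM; last first.
  by apply: (measurableT_comp (measurable_powR _)); apply: measurable_maxr.
apply: (measurableT_comp (measurable_powR _)).
by apply: measurable_funD => //; apply: measurable_funM => //; apply: measurable_funB.
Qed.

Let ih : leb.-integrable `[t, T] (EFin \o h).
Proof.
rewrite (_ : EFin \o h = (fun s => (price - alpha * price)%:E * (EFin \o v) s) \+
  (fun s => (alpha * price)%:E * (EFin \o g) s))%E; last by apply/funext.
apply: integrableD => //; apply: integrableZl => //.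
by apply: integrableS ig => //; exact: measurable_itv.
Qed.

(** The integral of [h] equals [price * D] for a displacement of exactly [D], and grows with the
    displacement. For D = 0 the price vanishes, whence the guard [0 < D] in [zD]: the comparison
    with resting holds for every competitor. *)
Let price_D : price * D <= \int[leb]_(s in `[t, T]) h s.
Proof.
have ig' : leb.-integrable `[t, T] (EFin \o g) by apply: integrableS ig => //;
  exact: measurable_itv.
have iv := v_int T.
rewrite /h RintegralD//; last 2 first.
- exact: (integrableZl _ (price - alpha * price) iv).
- exact: (integrableZl _ (alpha * price) ig').
rewrite [X in X + _]RintegralZl// [X in _ + X]RintegralZl// int_v ?(ltW tT)//
  divfK ?gt_eqF//.
rewrite -Rintegral_itv_obnd_cbnd -?zg ?(ltW tT)//; last first.
  by apply: integrableS ig => //; exact: measurable_itv.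
have [D00|/negbTE Dn] := eqVneq D 0.
  by rewrite /price D00 mul0r powR0 ?gt_eqF// !(mulr0,mul0r,subrr,addr0).
have /zD zD' : 0 < D by rewrite lt_neqAle eq_sym Dn D0.
have : 0 <= alpha * price * (z T - z t - D) by rewrite mulr_ge0 ?subr_ge0// mulr_ge0// ltW.
by lra.
Qed.

Let r_le_cost : (\int[leb]_(s in `[t, T]) (r s)%:E <= plan_cost z)%E.
Proof.
apply: le_integral_minorant => //.
- by move=> s _; rewrite mule_ge0 ?lee_fin ?powR_ge0// /cost; case: ifP => _;
  rewrite ?leey// lee_fin powR_ge0.
have F := ae_filter_ringOfSetsType leb.
have := @filterI _ _ F _ _ (ae_neq t) (ae_neq T).
move=> /(@filterI _ _ F _ _ dz); apply: filterS.
move=> s [dzs [st sT]] /=; rewrite in_itv/= => /andP[ts sT'].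
have -> : derive1 z s = g s.
  rewrite derive1E; apply: derive_val; apply: dzs.
    by rewrite lt_neqAle eq_sym st.
  by rewrite lt_neqAle sT.
rewrite /cost /r; case: (leP 0 (g s)) => g0;
  last by rewrite gt0_muley ?leey// lte_fin gam_gt0.
by rewrite (max_idPr _) ?oppr_le0// addr0.
Qed.

Let ir : (plan_cost z < +oo)%E -> leb.-integrable `[t, T] (EFin \o r).
Proof.
move=> fin; apply/integrableP; split; first exact/measurable_EFinP.
by under eq_integral do rewrite gee0_abs ?lee_fin//; exact: le_lt_trans fin.
Qed.

Let cost_Rintegral : (plan_cost z < +oo)%E -> ((\int[leb]_(s in `[t,
  T]) r s)%:E <= plan_cost z)%E.
Proof.
by move=> fin; rewrite /Rintegral fineK//; apply: integrable_fin_num => //; exact: ir.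
Qed.

Lemma competitor_cost_ge : ((price * D)%:E <= plan_cost z)%E.
Proof.
have [->|fin] := eqVneq (plan_cost z) +oo%E; first by rewrite leey.
rewrite -ltey in fin; apply: le_trans (cost_Rintegral fin).
rewrite lee_fin (le_trans price_D)// le_Rintegral//; first exact: ir.
by move=> s /=; rewrite in_itv/= => /andP[ts _]; exact: h_le_r.
Qed.

(** The nonnegative function [r - h] has integral 0, so it vanishes almost everywhere; strictness in
    [h_lt_r] then gives [g = v] almost everywhere, and integrating this from [t] recovers the
    competitor at every point. *)
Lemma competitor_optimal : (plan_cost z <= (price * D)%:E)%E ->
  forall s, t <= s -> s <= T -> z s = optimal_plan (z t) s.
Proof.
move=> le; have fin : (plan_cost z < +oo)%E by rewrite (le_lt_trans le)// ltry.
have irh : leb.-integrable `[t, T] (EFin \o (r \- h)).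
  rewrite (_ : EFin \o _ = (EFin \o r) \- (EFin \o h))%E; last by apply/funext.
  by apply: integrableB => //; exact: ir.
have rh0 s : `[t, T]%classic s -> 0 <= r s - h s.
  by rewrite /= in_itv/= => /andP[ts _]; rewrite subr_ge0 h_le_r.
have I0' : \int[leb]_(s in `[t, T]) (r s - h s) = 0.
  apply/le_anti; rewrite Rintegral_ge0// andbT RintegralB//; last exact: ir.
  rewrite subr_le0 (le_trans _ price_D)// -lee_fin.
  exact: le_trans (cost_Rintegral fin) le.
have /ae_eq_integral_abs : (\int[leb]_(s in `[t, T]) `|(r s - h s)%:E| = 0)%E.
  have -> : (\int[leb]_(s in `[t, T]) `|(r s - h s)%:E| = \int[leb]_(s in `[t,
    T]) (r s - h s)%:E)%E.
    by apply: eq_integral => s; rewrite inE => ts; rewrite gee0_abs// lee_fin rh0.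
  rewrite -[LHS]fineK; last by apply: integrable_fin_num.
  by congr EFin; exact: I0'.
move=> /(_ (measurable_itv _)) ae0.
have {}ae0 : ae_eq leb `[t, T]%classic (fun s => (r s - h s)%:E) (cst 0%E).
  by apply: ae0; move/integrableP : irh => [].
have gv : {ae leb, forall s, `[t, T]%classic s -> g s = v s}.
  move: ae0; apply: filterS.
  move=> s /= + ts => /(_ ts) [] /eqP; rewrite subr_eq0 => /eqP rh.
  apply: contrapT => /eqP; move: ts; rewrite in_itv/= => /andP[ts _] /(h_lt_r ts).
  by rewrite rh ltxx.
move=> s ts sT; apply/eqP; rewrite /optimal_plan -/q [X in _ == X]addrC -subr_eq zg//.
rewrite Rintegral_itv_obnd_cbnd; last by apply: integrableS ig => //; exact: measurable_itv.
rewrite -int_v// /Rintegral; apply/eqP; congr fine.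
apply: ae_eq_integral => //.
- by apply/measurable_EFinP; exact: measurable_funS mg.
- by have /integrableP[] := v_int s.
have F := ae_filter_ringOfSetsType leb; move: gv; apply: filterS.
move=> y /= + ys; rewrite in_itv/= => -> //.
by move: ys; rewrite !in_itv/= => /andP[-> ys]/=; exact: le_trans sT.
Qed.

End Competitor.

End SingleGoal.

End Optimum.

(** * Minimizers and the speed that the agent chooses *)

Lemma is_derive_right_derivative (R : realType) (f : R -> R) (t a : R) :
  is_derive t 1 f a -> right_derivative_at f t a.
Proof.
move=> /is_derive1_caratheodory[g [fg cg <-]].
have : g s @[s --> t^'+] --> g t by exact: cvg_at_right_filter.
apply: cvg_trans; apply: near_eq_cvg; near=> s.
have ts : s - t != 0 by rewrite subr_eq0 gt_eqF//; near: s; exact: nbhs_right_gt.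
by rewrite fg mulfK.
Unshelve. all: by end_near. Qed.

Lemma right_derivative_unique (R : realType) (f g : R -> R) (t T d e : R) : t < T ->
  (forall s, t <= s -> s <= T -> f s = g s) ->
  right_derivative_at f t d -> right_derivative_at g t e -> d = e.
Proof.
move=> tT fg fd ge; have fe : right_derivative_at f t e; last first.
  by rewrite -(cvg_lim (@Rhausdorff R) fd) -(cvg_lim (@Rhausdorff R) fe).
move: ge; apply: cvg_trans; apply: near_eq_cvg; near=> s.
have ts : t <= s by near: s; exact: nbhs_right_ge.
have sT : s <= T by near: s; exact: nbhs_right_le.
by rewrite !fg// ltW.
Unshelve. all: by end_near. Qed.

Section ChosenSpeed.
Context {R : realType}.
Variables (alpha lambda mu : R).
Hypotheses (halpha : 1 < alpha) (hlambda : 0 < lambda) (hmu : 0 < mu).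
Variables (T rew theta t x : R).
Hypotheses (hrew : 0 <= rew) (tT : t < T).
Local Notation effort := (effort alpha lambda mu).
Local Notation plan := (optimal_plan alpha lambda mu T t).
Local Notation price := (price alpha lambda mu T t).
Local Notation plan_cost := (plan_cost alpha lambda mu T t).
Local Notation prize := (discount lambda mu t T * rew).

Let prize_ge0 : 0 <= prize. Proof. by rewrite mulr_ge0// powR_ge0. Qed.

Lemma AC_cost_ge (z : R -> R) D : absolutely_continuous_on t T z -> 0 <= D ->
  (0 < D -> D <= z T - z t) -> ((price D * D)%:E <= plan_cost z)%E.
Proof.
move=> acz D0 zD; have [g [ig zg dz]] := absolutely_continuous_density tT acz.
exact: (competitor_cost_ge halpha hlambda hmu tT D0 ig zg dz zD).
Qed.

Lemma AC_cost_optimal (z : R -> R) D : absolutely_continuous_on t T z -> 0 <= D ->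
  (0 < D -> D <= z T - z t) -> (plan_cost z <= (price D * D)%:E)%E ->
  forall s, t <= s -> s <= T -> z s = plan D (z t) s.
Proof.
move=> acz D0 zD; have [g [ig zg dz]] := absolutely_continuous_density tT acz.
exact: (competitor_optimal halpha hlambda hmu tT D0 ig zg dz zD).
Qed.

Lemma optimal_plan_plans D : 0 <= D -> plans T t x (plan D x).
Proof.
by move=> D0; split; [exact: optimal_plan_AC|exact: optimal_plan_start].
Qed.

Lemma perceived_cost_optimal D : 0 <= D ->
  perceived_cost alpha lambda mu T rew theta t (plan D x) =
  (price D * D - prize * (theta <= x + D)%R%:R)%:E.
Proof.
move=> D0; rewrite /perceived_cost -/(plan_cost _) plan_cost_optimal//.
by rewrite optimal_plan_end.
Qed.

(** A minimizer that misses the goal, or starts beyond it, costs no more than resting and hence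
    rests. One that reaches the goal from below earns the same prize as the cheapest plan ending
    exactly there, hence coincides with that plan; comparison with resting bounds its cost by the
    prize. *)
Lemma minimizer_cases z : minimizer alpha lambda mu T rew theta t x z ->
  exists2 D, D = 0 \/ [/\ D = theta - x, x < theta & price D * D <= prize] &
    forall s, t <= s -> s <= T -> z s = plan D x s.
Proof.
move=> [[acz zx] minz].
have Hw D : 0 <= D ->
    (plan_cost z <= (price D * D - prize * (theta <= x + D)%R%:R + prize * (theta <= z
      T)%R%:R)%:E)%E.
  move=> D0; have := minz _ (optimal_plan_plans D0); rewrite perceived_cost_optimal//.
  by rewrite /perceived_cost leeBlDr// EFinD.
have stay : (plan_cost z <= 0)%E -> exists2 D, D = 0 \/ [/\ D = theta - x,
  x < theta & price D * D <= prize] &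
    forall s, t <= s -> s <= T -> z s = plan D x s.
  move=> z0; exists 0; first by left.
  rewrite -zx; apply: AC_cost_optimal => //; first by rewrite ltxx.
  by rewrite mulr0.
have /orP[tx|xt] : (theta <= x) || (x < theta) by case: ltP.
  apply: stay; apply: le_trans (Hw 0 (lexx _)) _; rewrite mulr0 addr0 tx lee_fin.
  by case: (theta <= z T); rewrite ?mulr1 ?mulr0 ?addr0 sub0r ?addNr ?oppr_le0.
have D0 : 0 < theta - x by rewrite subr_gt0.
have [tz|zt] := leP theta (z T); last first.
  apply: stay; apply: le_trans (Hw 0 (lexx _)) _.
  by rewrite addr0 [theta <= x]leNgt xt [theta <= z T]leNgt zt !mulr0 subr0 addr0.
have zD : 0 < theta - x -> theta - x <= z T - z t by move=> _; rewrite zx lerD2r.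
exists (theta - x).
  right; split => //.
  have := le_trans (AC_cost_ge acz (ltW D0) zD) (Hw 0 (lexx _)).
  by rewrite lee_fin addr0 tz mulr1 [theta <= x]leNgt xt !mulr0 subr0 add0r.
have := Hw _ (ltW D0); rewrite subrKC lexx tz mulr1 subrK => zcost.
by have := AC_cost_optimal acz (ltW D0) zD zcost; rewrite zx.
Qed.

Lemma right_derivative_optimal_plan D : 0 <= D ->
  right_derivative_at (plan D x) t (D / effort (T - t)).
Proof.
move=> D0; apply: is_derive_right_derivative.
have := is_derive_optimal_plan halpha hlambda hmu T D x (lexx t).
by rewrite subrr mulr0 addr0 powR1 mulr1.
Qed.

Lemma minimizer_right_derivative z d : minimizer alpha lambda mu T rew theta t x z ->
  right_derivative_at z t d ->
  d = 0 \/ [/\ x < theta, price (theta - x) * (theta - x) <= prize &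
             d = (theta - x) / effort (T - t)].
Proof.
move=> /minimizer_cases[D HD zD] zd.
have D0 : 0 <= D by case: HD => [->//|[-> xt _]]; rewrite subr_ge0 ltW.
rewrite (right_derivative_unique tT zD zd (right_derivative_optimal_plan D0)).
by case: HD => [->|[-> xt le]]; [left; rewrite mul0r|right].
Qed.

Lemma chosen_speed_cases d : chosen_speed alpha lambda mu T rew theta t x d ->
  d = 0 \/ [/\ x < theta, price (theta - x) * (theta - x) <= prize &
             d = (theta - x) / effort (T - t)].
Proof. by move=> [z [mz zd _]]; exact: minimizer_right_derivative zd. Qed.

(** The inequality is weak because of the tie-break: when resting and working cost the same, the
    larger initial derivative wins. *)
Lemma chosen_speed_work : x <= theta -> price (theta - x) * (theta - x) <= prize ->
  chosen_speed alpha lambda mu T rew theta t x ((theta - x) / effort (T - t)).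
Proof.
move=> xt le; have D0 : 0 <= theta - x by rewrite subr_ge0.
exists (plan (theta - x) x); split.
- split; first exact: optimal_plan_plans.
  move=> z [acz zx]; rewrite perceived_cost_optimal// subrKC lexx mulr1.
  rewrite /perceived_cost -/(plan_cost z) leeBrDr// -EFinD.
  have [tz|zt] := leP theta (z T).
    by rewrite mulr1 subrK; apply: AC_cost_ge => // _; rewrite zx lerD2r.
  rewrite mulr0 addr0; apply: le_trans (plan_cost_ge0 _ _ _ _ _ _).
  by rewrite lee_fin subr_le0.
- exact: right_derivative_optimal_plan.
move=> z e mz ze; have [->|[_ _ ->]//] := minimizer_right_derivative mz ze.
by rewrite divr_ge0// ltW// effort_gt0// subr_gt0.
Qed.

End ChosenSpeed.

(** * Monotonicity of absolutely continuous functions *)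

Section AbsolutelyContinuousFacts.
Context {R : realType}.
Implicit Types (a b u v t : R) (f g : R -> R).
Local Notation leb := (@lebesgue_measure R).

Lemma absolutely_continuous_sub a b u v f : a <= u -> v <= b ->
  absolutely_continuous_on a b f -> absolutely_continuous_on u v f.
Proof.
move=> au vb acf e e0; have [d d0 H] := acf e e0; exists d => // n x y xy; apply: H.
by move=> i; have [ux [xyi yv]] := xy i; rewrite (le_trans au ux) (le_trans yv vb).
Qed.

Lemma absolutely_continuous_unif a b f : absolutely_continuous_on a b f ->
  forall e : R, 0 < e -> exists2 d : R, 0 < d & forall u v, a <= u -> u <= v -> v <= b ->
    v - u < d -> `|f v - f u| < e.
Proof.
move=> acf e e0; have [d d0 H] := absolutely_continuous_seq acf e0;
  exists d => // u v au uv vb uvd.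
have := H [:: (u, v)]; rewrite !big_cons !big_nil !addr0 /=; apply => //.
by rewrite /admissible /= au uv vb.
Qed.

Lemma absolutely_continuous_within a b f : a < b -> absolutely_continuous_on a b f ->
  {within `[a, b], continuous f}.
Proof.
move=> ab acf; have U := absolutely_continuous_unif acf.
apply/continuous_within_itvP => //; split.
- move=> t; rewrite in_itv/= => /andP[at_ tb]; apply/cvgrPdist_lt => e e0.
  have [d d0 H] := U e e0; near=> s.
  have as_ : a <= s by apply/ltW; near: s; exact: lt_nbhsr.
  have sb : s <= b by apply/ltW; near: s; exact: lt_nbhsl.
  have : `|t - s| < d by near: s; exists d.
  case: (leP s t) => st; first by rewrite ger0_norm ?subr_ge0// => sd; apply: H => //;
    exact: ltW.
  rewrite distrC ger0_norm ?subr_ge0 ?(ltW st)// => sd.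
  by rewrite distrC; apply: H => //; exact: ltW.
- apply/cvgrPdist_lt => e e0; have [d d0 H] := U e e0; near=> s.
  have as_ : a <= s by near: s; exact: nbhs_right_ge.
  rewrite distrC; apply: H => //; first by near: s; exact: nbhs_right_le.
  by rewrite ltrBlDl; near: s; apply: nbhs_right_lt; rewrite ltrDl.
- apply/cvgrPdist_lt => e e0; have [d d0 H] := U e e0; near=> s.
  have as_ : a <= s by near: s; exact: nbhs_left_ge.
  have sb : s <= b by near: s; exact: nbhs_left_le.
  apply: H => //; rewrite ltrBlDr -ltrBlDl.
  by near: s; apply: nbhs_left_gt; rewrite ltrBlDr ltrDl.
Unshelve. all: by end_near. Qed.

(** The increment is the integral of a density that is nonnegative almost everywhere. Absolute
    continuity is essential: the negated Cantor function has derivative 0 almost everywhere, yet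
    decreases. *)
Lemma absolutely_continuous_ae_nondecreasing a b f : a <= b ->
  absolutely_continuous_on a b f ->
  {ae leb, forall t, a < t -> t < b -> exists2 d, is_derive t 1 f d & 0 <= d} ->
  f a <= f b.
Proof.
rewrite le_eqVlt => /predU1P[->//|ab acf df].
have [g [ig fg dg]] := absolutely_continuous_density ab acf.
have iab : leb.-integrable `]a, b] (EFin \o g) by apply: integrableS ig => //;
  exact: measurable_itv.
rewrite -subr_ge0 fg ?(ltW ab)//.
have F := ae_filter_ringOfSetsType leb.
have gge0 : {ae leb, forall t, `]a, b]%classic t -> (g t)%:E = (Num.max (g t) 0)%:E}.
  have := @filterI _ _ F _ _ df (@filterI _ _ F _ _ dg (ae_neq b)).
  apply: filterS => t [dft [dgt tb]] /=; rewrite in_itv/= => /andP[at_ tb'].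
  have tltb : t < b by rewrite lt_neqAle tb.
  have [d fd d0] := dft at_ tltb; have fg' := dgt at_ tltb.
  have -> : g t = d by rewrite -(@derive_val _ _ _ _ _ _ _ fd) (@derive_val _ _ _ _ _ _ _
    fg').
  by rewrite (max_idPl d0).
have mg : measurable_fun `]a, b]%classic g.
  by move/integrableP : iab => [/measurable_EFinP].
rewrite /Rintegral.
have -> : (\int[leb]_(t in `]a, b]) (g t)%:E = \int[leb]_(t in `]a,
  b]) (Num.max (g t) 0)%:E)%E.
  apply: ae_eq_integral => //; first exact/measurable_EFinP.
  by apply/measurable_EFinP; exact: measurable_maxr.
by apply: fine_ge0; apply: integral_ge0 => t _; rewrite lee_fin le_max lexx orbT.
Qed.

Lemma absolutely_continuous_opp a b f : absolutely_continuous_on a b f ->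
  absolutely_continuous_on a b (fun t => - f t).
Proof.
move=> acf e e0; have [d d0 H] := acf e e0; exists d => // n u v uv tuv uvd.
rewrite (eq_bigr (fun i => `|f (v i) - f (u i)|)); first exact: H.
by move=> i _; rewrite -opprD normrN.
Qed.

Lemma absolutely_continuous_mul a b f g (M : R) :
  absolutely_continuous_on a b f -> absolutely_continuous_on a b g ->
  (forall t, a <= t -> t <= b -> `|f t| <= M /\ `|g t| <= M) ->
  absolutely_continuous_on a b (fun t => f t * g t).
Proof.
move=> acf acg fgM e e0.
pose K := `|M| + 1; have K0 : 0 < K by rewrite ltr_wpDl.
have MK : M <= K by rewrite (le_trans (ler_norm _))// lerDl.
have e2 : 0 < e / K / 2 by rewrite !divr_gt0.
have [d1 d10 H1] := acf _ e2; have [d2 d20 H2] := acg _ e2.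
exists (Num.min d1 d2); first by rewrite lt_min d10.
move=> n u v uv tuv; rewrite lt_min => /andP[uvd1 uvd2].
have := ltrD (H1 _ _ _ uv tuv uvd1) (H2 _ _ _ uv tuv uvd2).
rewrite -splitr ltr_pdivlMr// -big_split/= mulr_suml; apply: le_lt_trans.
apply: ler_sum => i _; have [au [uvi vb]] := uv i.
have [_ gM] := fgM _ (le_trans au uvi) vb; have [fM _] := fgM _ au (le_trans uvi vb).
rewrite (_ : _ - _ = (f (v i) - f (u i)) * g (v i) + f (u i) * (g (v i) - g (u i)));
  last by ring.
rewrite (le_trans (ler_normD _ _))// !normrM mulrDl lerD//.
  by rewrite ler_wpM2l// (le_trans gM).
by rewrite mulrC ler_wpM2l// (le_trans fM).
Qed.

End AbsolutelyContinuousFacts.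

(** * Trajectories *)

Section Trajectory.
Context {R : realType}.
Variables (alpha lambda mu : R).
Hypotheses (halpha : 1 < alpha) (hlambda : 0 < lambda) (hmu : 0 < mu).
Variables (T rew theta : R).
Hypotheses (hT : 0 < T) (hrew : 0 <= rew) (htheta : 0 <= theta).
Implicit Types (s t u v x D : R).
Local Notation leb := (@lebesgue_measure R).
Local Notation p := (expo alpha lambda mu).
Local Notation I := (effort alpha lambda mu).

Let a1 : 0 < alpha - 1. Proof. by rewrite subr_gt0. Qed.
Let al0 : 0 < alpha. Proof. exact: lt_trans halpha. Qed.
Let p1 : 1 < p. Proof. exact: expo_gt1. Qed.
Let p0 : 0 < p. Proof. exact: lt_trans p1. Qed.
Let lp0 : 0 < lambda * p. Proof. by rewrite mulr_gt0. Qed.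

Let b t : R := 1 + lambda * (T - t).
(** Up to the factor [lambda * p], the relative rate at which the distance of a working agent
    shrinks. This is the integrand in f_T. *)
Let q t : R := (b t `^ p - 1)^-1.

Let b1 t : t < T -> 1 < b t. Proof. by move=> tT; rewrite base_gt1// subr_gt0. Qed.
Let b0 t : t <= T -> 0 < b t. Proof. by move=> tT; rewrite base_gt0// subr_ge0. Qed.
Let bp1 t : t < T -> 0 < b t `^ p - 1. Proof. by move=> tT;
  rewrite subr_gt0 powR_gt1// b1. Qed.
Let I0 t : t < T -> 0 < I (T - t). Proof. by move=> tT; rewrite effort_gt0// subr_gt0. Qed.
Let q0 t : t < T -> 0 < q t. Proof. by move=> tT; rewrite invr_gt0 bp1. Qed.

Let qE t : lambda * p * q t = (I (T - t))^-1.
Proof. by rewrite /q /effort invf_div. Qed.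

Let cq t : t < T -> {for t, continuous q}.
Proof.
move=> tT; have d : is_derive t 1 (fun s => b s `^ p - 1) (- (lambda * p * b t `^ (p - 1))).
  have := is_derive_shiftf (-1) (is_derive_reflect (is_derive_base_powR p (b0 (ltW tT)))).
  by congr is_derive; apply/funext => s; rewrite addrC.
by apply: (@continuousV _ _ (fun s => b s `^ p - 1));
  [rewrite gt_eqF// bp1|exact: is_derive_continuous d].
Qed.

(* The base point -1 makes the primitive differentiable at 0. *)
Lemma working_rate_primitive : exists Q : R -> R, forall t,
  -1 < t -> t < T -> is_derive t 1 Q (q t).
Proof.
exists (fun t => \int[leb]_(s in `[-1, t]) q s) => t t1 tT.
have [u tu uT] : exists2 u, t < u & u < T by exists ((t + T) / 2); rewrite midf_lt.
have iq : leb.-integrable `[-1, u] (EFin \o q).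
  by apply: continuous_segment_integrable => s _ su; apply: cq; exact: le_lt_trans uT.
have [dq <-] := continuous_FTC1_closed tu iq t1 (cq tT).
by rewrite derive1E; apply: DeriveDef.
Qed.

(** The least reward, per unit of D^alpha, that makes it worthwhile at time [t] to cover the
    remaining distance D: the cost of doing so divided by the discount of the prize. *)
Definition urgency t : R :=
  (I (T - t))^-1 `^ (alpha - 1) * (1 + lambda * (T - t)) `^ (mu / lambda).

(** This explains f_T: the distance left to an agent that has worked since time 0 is theta exp(-
    lambda p (Q t - Q 0)), and the exponential in f_T is the alpha-th power of this decay. *)
Lemma fT_urgency (Q : R -> R) t : (forall t, -1 < t -> t < T -> is_derive t 1 Q (q t)) ->
  0 <= t -> t < T ->
  theta `^ alpha * fT alpha lambda mu T t =
    (theta * expR (- (lambda * p * (Q t - Q 0)))) `^ alpha * urgency t.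
Proof.
move=> dQ t0 tT; rewrite powRM ?expR_ge0// -expRM /fT /urgency.
have pE : mu / (lambda * (alpha - 1)) + 1 = p by [].
have intE : \int[leb]_(s in `[0, t]) ((1 + lambda * (T - s)) `^ p - 1)^-1 = Q t - Q 0.
  have dQ' s : 0 <= s -> s <= t -> is_derive s 1 Q (q s).
    by move=> s0 st; apply: dQ; [exact: lt_le_trans s0|exact: le_lt_trans tT].
  have cq' s : 0 <= s -> s <= t -> {for s, continuous q}.
    by move=> s0 st; apply: cq; exact: le_lt_trans tT.
  exact: (is_derive_Rintegral t0 dQ' cq').
rewrite !pE intE -/(b t).
have -> : (mu + lambda * (alpha - 1)) / ((alpha - 1) * (b t `^ p - 1)) = (I (T - t))^-1.
  rewrite -qE /q; have : b t `^ p - 1 != 0 by rewrite gt_eqF ?bp1.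
  move: (_ `^ _ - 1) => y y0; rewrite /expo; field.
  by rewrite y0 !gt_eqF.
have -> : - (alpha * (mu / (alpha - 1) + lambda) * (Q t - Q 0)) = - (lambda * p * (Q t -
  Q 0)) * alpha.
  by rewrite /expo; field; rewrite !gt_eqF.
by ring.
Qed.

Lemma urgency_gt0 t : t < T -> 0 < urgency t.
Proof. by move=> tT; rewrite mulr_gt0// powR_gt0 ?invr_gt0 ?I0// b0// ltW. Qed.

Lemma price_le_prize D t : 0 <= D -> t < T ->
  (price alpha lambda mu T t D * D <= discount lambda mu t T * rew) = (D `^ alpha *
    urgency t <= rew).
Proof.
move=> D0 tT; have B : 0 < b t `^ (mu / lambda) by rewrite powR_gt0// b0// ltW.
rewrite /discount powRN -/(b t) [_^-1 * rew]mulrC ler_pdivlMr// /price /urgency.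
rewrite powRM// ?invr_ge0 ?(ltW (I0 tT))// -(mulr_powRB1 D0 al0).
by congr (_ <= _); rewrite -/(b t); ring.
Qed.

(** Up to a constant, [urgency] is the (alpha - 1)-th power of b^(p - 1) / (b^p - 1) = 1 / (b - b^(1
    - p)), which decreases in b, while b decreases in time. Hence an agent for whom the goal is too
    far never resumes work. *)
Lemma urgency_nondecreasing s t : s <= t -> t < T -> urgency s <= urgency t.
Proof.
move=> st tT; have sT := le_lt_trans st tT.
have E r : r < T -> urgency r = ((I (T - r))^-1 * b r `^ (p - 1)) `^ (alpha - 1).
  move=> rT; rewrite /urgency (@expoE _ alpha lambda mu halpha hlambda) [(alpha - 1) *
    _]mulrC powRrM powRM ?powR_ge0//.
  by rewrite invr_ge0 ltW// I0.
have X r : r < T -> 0 <= (I (T - r))^-1 * b r `^ (p - 1).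
  by move=> rT; rewrite mulr_ge0 ?powR_ge0// invr_ge0 ltW// I0.
rewrite (E _ sT) (E _ tT); apply: (ge0_ler_powR (ltW a1)); [exact: X|exact: X|].
rewrite -!qE -!mulrA ler_pM2l// ler_pM2l// /q.
rewrite ler_pdivrMl ?bp1// mulrCA ler_pdivlMl ?bp1//.
have bp r : r < T -> b r `^ p = b r * b r `^ (p - 1).
  by move=> rT; rewrite mulr_powRB1 ?(ltW (b0 _)) ?(ltW rT).
have bts : b t <= b s by rewrite lerD2l ler_wpM2l ?(ltW hlambda)// lerD2l lerN2.
have le2 : b t `^ (p - 1) <= b s `^ (p - 1).
  by rewrite ge0_ler_powR ?nnegrE ?subr_ge0 ?(ltW p1)// ltW// b0// ltW.
have : 0 <= b t `^ (p - 1) * b s `^ (p - 1) * (b s - b t).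
  by rewrite !mulr_ge0 ?powR_ge0// subr_ge0.
by rewrite !bp//; lra.
Qed.

Section Bound.
Variable x : R -> R.
Hypotheses (acx : absolutely_continuous_on 0 T x) (xT : x T = theta)
  (dx : {ae leb, forall t : R, t \in `[0, T[ ->
     exists2 d : R, is_derive t 1 x d &
       chosen_speed alpha lambda mu T rew theta t (x t) d}).

Let speed_cases : {ae leb, forall t, 0 < t -> t < T -> exists2 d, is_derive t 1 x d &
  d = 0 \/ [/\ x t < theta, (theta - x t) `^ alpha * urgency t <= rew &
            d = (theta - x t) / I (T - t)]}.
Proof.
have F := ae_filter_ringOfSetsType leb; move: dx; apply: filterS => t H t0 tT.
have [|d xd cd] := H; first by rewrite in_itv/= (ltW t0).
exists d => //; have [->|[xt le ->]] := chosen_speed_cases halpha hlambda hmu hrew tT cd.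
  by left.
by right; split => //; rewrite -price_le_prize// subr_ge0 ltW.
Qed.

Let x_nondecreasing u v : 0 <= u -> u <= v -> v <= T -> x u <= x v.
Proof.
move=> u0 uv vT; apply: absolutely_continuous_ae_nondecreasing => //.
  exact: absolutely_continuous_sub acx.
have F := ae_filter_ringOfSetsType leb; move: speed_cases; apply: filterS => t H ut tv.
have tT := lt_le_trans tv vT.
have [d xd cd] := H (le_lt_trans u0 ut) tT; exists d => //.
by case: cd => [->//|[xt _ ->]]; rewrite divr_ge0 ?subr_ge0// ltW// I0.
Qed.

Let x_le t : 0 <= t -> t <= T -> x t <= theta.
Proof. by move=> t0 tT; rewrite -xT; exact: x_nondecreasing. Qed.

(* While the remaining distance is too large the agent rests, so the progress
   cannot leave its current value. *)
Let worth_working t : 0 <= t -> t < T -> (theta - x t) `^ alpha * urgency t <= rew.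
Proof.
move=> t0 tT; rewrite leNgt; apply/negP => lt.
have h0 := urgency_gt0 tT.
have D0 : 0 <= theta - x t by rewrite subr_ge0 x_le// ltW.
(* [D1] is the break-even distance at time [t], and [D2] lies strictly between it and the actual
   distance. To end at the goal the agent must be at distance [D2] at some time [c]; until then its
   distance is at least [D2], so it rests and cannot have moved. *)
pose D1 := (rew / urgency t) `^ alpha^-1.
have D10 : 0 <= D1 by exact: powR_ge0.
have D1E : D1 `^ alpha * urgency t = rew.
  by rewrite -powRrM mulVf ?gt_eqF// powRr1 ?divr_ge0 ?(ltW h0)// divfK// gt_eqF.
have D1D : D1 < theta - x t.
  rewrite ltNge; apply/negP => le; move: lt; rewrite ltNge => /negP; apply.
  by rewrite -D1E ler_pM2r// ge0_ler_powR// ltW.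
pose D2 := (D1 + (theta - x t)) / 2.
have D12 : D1 < D2 by rewrite /D2; lra.
have D2D : D2 < theta - x t by rewrite /D2; lra.
have [c + xc] : exists2 c, c \in `[t, T] & x c = theta - D2.
  apply: IVT; first exact: ltW.
    apply: absolutely_continuous_within => //.
    exact: (absolutely_continuous_sub t0 (lexx _) acx).
  by rewrite xT ge_min le_max; apply/andP; split; apply/orP; [left|right]; lra.
rewrite in_itv/= => /andP[tc cT'].
have cT : c < T.
  rewrite lt_neqAle cT' andbT; apply/eqP => cT; move: xc; rewrite cT xT; lra.
suff : x c <= x t by rewrite xc; lra.
rewrite -lerN2; apply: (@absolutely_continuous_ae_nondecreasing _ _ _ (fun s => - x s) tc).
  by apply: absolutely_continuous_opp; exact: absolutely_continuous_sub acx.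
have F := ae_filter_ringOfSetsType leb; move: speed_cases; apply: filterS => s H ts sc.
have sT := lt_trans sc cT.
have [d xd [d0|[_ + _]]] := H (le_lt_trans t0 ts) sT.
  by exists (- d); [exact: is_derive_oppf|rewrite d0 oppr0].
have xsc : x s <= x c by apply: x_nondecreasing => //;
  [exact/ltW/(le_lt_trans t0)|exact: ltW].
have D2s : D2 <= theta - x s by lra.
rewrite leNgt => /negP[].
apply: (@lt_le_trans _ _ (D2 `^ alpha * urgency t)).
  by rewrite -D1E ltr_pM2r// gt0_ltr_powR// nnegrE// ltW// (le_lt_trans D10).
apply: ler_pM; rewrite ?powR_ge0 ?(ltW h0)//; last by apply: urgency_nondecreasing => //;
  exact: ltW.
by rewrite ge0_ler_powR ?(ltW al0)// nnegrE; lra.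
Qed.

(** The product (theta - x) exp(lambda p Q) has derivative 0 while the agent works and a nonnegative
    one while it rests. So the agent is never closer to the goal than one that has always worked,
    and [worth_working] applies to a distance at least that large. *)
Lemma trajectory_bound : x 0 = 0 -> forall t, 0 <= t -> t < T ->
  theta `^ alpha * fT alpha lambda mu T t <= rew.
Proof.
move=> x0 t t0 tT; have [Q dQ] := working_rate_primitive.
rewrite (fT_urgency dQ t0 tT); apply: le_trans (worth_working t0 tT).
rewrite ler_pM2r ?urgency_gt0//; apply: ge0_ler_powR; rewrite ?nnegrE ?(ltW al0)//.
- by rewrite mulr_ge0// expR_ge0.
- by rewrite subr_ge0 x_le// ltW.
have dQ' s : 0 <= s -> s <= t -> is_derive s 1 (fun s => expR (lambda * p * Q s))
    (expR (lambda * p * Q s) * (lambda * p * q s)).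
  move=> s0 st; have /(is_derive_scalef (lambda * p)) dQs : is_derive s 1 Q (q s).
    by apply: dQ; [exact: lt_le_trans s0|exact: le_lt_trans tT].
  exact: (@is_derive_compf _ expR (fun s => lambda * p * Q s)).
have cexp : {within `[0, t], continuous (fun s => `|expR (lambda * p * Q s) * (lambda * p
  * q s)|)}.
  apply: continuous_in_subspaceT => s; rewrite inE/= in_itv/= => /andP[s0 st].
  apply: cvg_norm.
  apply: (@continuousM _ _ (fun s => expR (lambda * p * Q s)) (fun s => lambda * p * q s)).
    exact: is_derive_continuous (dQ' _ s0 st).
  apply: (@continuousM _ _ (fun=> lambda * p) q); first exact: cvg_cst.
  by apply: cq; exact: le_lt_trans tT.
have [c _ cM] := EVT_max t0 cexp.
have acexp : absolutely_continuous_on 0 t (fun s => expR (lambda * p * Q s)).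
  apply: lipschitz_absolutely_continuous; apply: (is_derive_lipschitz dQ') => s s0 st.
  by apply: cM; rewrite in_itv/= s0.
have ndQ u v : 0 <= u -> u <= v -> v <= t -> Q u <= Q v.
  move=> u0; rewrite le_eqVlt => /predU1P[->//|uv] vt.
  have [s us sv|r /andP[ur rv] E] := @is_derive_MVT _ Q q u v uv.
    apply: dQ; last exact: (le_lt_trans (le_trans sv vt) tT).
    by apply: lt_le_trans us; apply: lt_le_trans u0; rewrite ltrN10.
  rewrite -subr_ge0 E; apply: mulr_ge0; last by rewrite subr_ge0 ltW.
  by apply/ltW/q0/(lt_trans rv)/(le_lt_trans vt).
pose M := Num.max theta (expR (lambda * p * Q t)).
have : (theta - x 0) * expR (lambda * p * Q 0) <= (theta - x t) * expR (lambda * p * Q t).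
  have acD : absolutely_continuous_on 0 t (fun s => theta - x s).
    move=> e e0; have [d d0 H] := absolutely_continuous_sub (lexx 0) (ltW tT) acx e0.
    exists d => // n u v uv tuv uvd; rewrite (eq_bigr (fun i => `|x (v i) - x (u i)|));
      first exact: H.
    by move=> i _; rewrite distrC; congr (`|_|); ring.
  apply: (@absolutely_continuous_ae_nondecreasing _ 0 t (fun s => (theta - x s) * expR
    (lambda * p * Q s))) => //.
    apply: (@absolutely_continuous_mul _ _ _ _ _ M) => // s s0 st; split.
      have sT := le_trans st (ltW tT).
      rewrite ger0_norm ?subr_ge0 ?x_le// le_max lerBlDr lerDl.
      by rewrite -x0 (x_nondecreasing (lexx _) s0 sT).
    rewrite ger0_norm ?expR_ge0// le_max ler_expR ler_pM2l// ndQ ?orbT//.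
  have F := ae_filter_ringOfSetsType leb; move: speed_cases; apply: filterS => s H s0 st.
  have sT := lt_trans st tT.
  have [d xd cd] := H s0 sT.
  have dD : is_derive s 1 (fun s => theta - x s) (- d).
    by apply: is_derive_shiftf; exact: is_derive_oppf.
  exists ((theta - x s) * (expR (lambda * p * Q s) * (lambda * p * q s)) + expR (lambda *
    p * Q s) * (- d)).
    exact: (is_derive_mulf dD (dQ' _ (ltW s0) (ltW st))).
  rewrite mulrCA -mulrDr mulr_ge0 ?expR_ge0// qE subr_ge0.
  case: cd => [->|[_ _ ->]//].
  by rewrite mulr_ge0 ?subr_ge0 ?x_le ?(ltW s0) ?(ltW sT)// invr_ge0 ltW// I0.
rewrite x0 subr0 -ler_pdivrMr ?expR_gt0//; congr (_ <= _).
have -> : - (lambda * p * (Q t - Q 0)) = lambda * p * Q 0 - lambda * p * Q t by ring.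
by rewrite expRB mulrA.
Qed.

End Bound.

Lemma trajectory_exists :
  (forall t, 0 <= t -> t < T -> theta `^ alpha * fT alpha lambda mu T t <= rew) ->
  exists2 x, trajectory alpha lambda mu T rew theta x & theta = x T.
Proof.
move=> fle; have [Q dQ] := working_rate_primitive.
pose D t := theta * expR (- (lambda * p * (Q t - Q 0))).
have D0 t : 0 <= D t by rewrite mulr_ge0 ?expR_ge0.
have dD t : -1 < t -> t < T -> is_derive t 1 D (- (D t / I (T - t))).
  move=> t1 tT.
  have d1 : is_derive t 1 (fun t => - (lambda * p * (Q t - Q 0))) (- (lambda * p * q t)).
    apply: is_derive_oppf; apply: is_derive_scalef.
    have := is_derive_shiftf (- Q 0) (dQ t t1 tT).
    by congr is_derive; apply/funext => s; rewrite addrC.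
  have := is_derive_scalef theta (@is_derive_compf _ expR (fun t => - (lambda * p * (Q t
    - Q 0))) t _ _ (is_derive_expR _) d1).
  by congr is_derive; rewrite qE /D; ring.
(* The speed stays bounded although the rate [1 / I (T - t)] blows up at [T]. *)
pose V := theta / I T * expR (lambda * p * T).
have V0 : 0 <= V by rewrite mulr_ge0 ?expR_ge0// divr_ge0// effort_ge0// ltW.
have DV t : 0 <= t -> t < T -> D t <= V * I (T - t).
  move=> t0 tT.
  (* This derivative equals (b^p - b^(p - 1)) / I, which is nonnegative since b >= 1. The added term
     [lambda * p * s] secures that sign and accounts for the factor exp(lambda p T) in [V]. *)
  have dK s : 0 <= s -> s <= t -> is_derive s 1 (fun s => lambda * p * Q s + (ln (I (T -
    s)) + lambda * p * s))
      (lambda * p * q s + (- ((1 + lambda * (T - s)) `^ (p - 1) / I (T - s)) + lambda * p)).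
    move=> s0 st; have sT := le_lt_trans st tT.
    apply: is_derive_addf.
      by apply: is_derive_scalef; apply: dQ => //; exact: lt_le_trans s0.
    apply: is_derive_addf; last first.
      by have := is_derive_affine 0 (lambda * p) s; congr is_derive; apply/funext => r;
        rewrite add0r.
    have dI : is_derive (T - s) 1 (fun u => ln (I u)) ((I (T - s))^-1 * (1 + lambda * (T
      - s)) `^ (p - 1)).
      apply: is_derive_compf; first exact: is_derive1_ln (I0 sT).
      by apply: is_derive_effort => //; rewrite subr_ge0 ltW.
    by have := is_derive_reflect dI; congr is_derive; rewrite mulrC.
  have K : lambda * p * Q 0 + ln (I T) <= lambda * p * Q t + (ln (I (T - t)) + lambda * p
    * t).
    move: t0; rewrite le_eqVlt => /predU1P[<-|t0]; first by rewrite subr0 mulr0 addr0.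
    have [c /andP[c0 ct] E] := is_derive_MVT t0 dK.
    move: E; rewrite !subr0 mulr0 addr0 => E; rewrite -subr_ge0 E mulr_ge0 ?(ltW t0)//.
    have cT := lt_trans ct tT; rewrite qE.
    rewrite -(pmulr_lge0 _ (I0 cT)) mulrDl mulrDl mulVf ?gt_eqF ?I0//
      mulNr divfK ?gt_eqF ?I0//.
    have -> : lambda * p * I (T - c) = b c `^ p - 1 by rewrite /effort mulrC divfK// gt_eqF.
    have : b c `^ (p - 1) <= b c `^ p by rewrite ler_powR ?(ltW (b1 _))// gerBl.
    by rewrite -/(b c); lra.
  rewrite /D /V (_ : theta / I T * _ * _ = theta * ((I T)^-1 * (expR (lambda * p * T) * I
    (T - t)))); last by ring.
  rewrite ler_wpM2l// -ler_pdivrMl ?invr_gt0 ?effort_gt0// invrK.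
  rewrite -[I T]lnK ?posrE ?effort_gt0// -expRD.
  apply: (@le_trans _ _ (expR (lambda * p * t) * I (T - t))); last first.
    by rewrite ler_pM2r ?I0// ler_expR ler_pM2l// ltW.
  rewrite -[X in _ <= _ * X]lnK ?posrE ?I0// -expRD ler_expR.
  by move: K; rewrite mulrBr; lra.
(* [W] bounds the derivative of the effort, so that [DV] becomes a Lipschitz estimate up to the
   final time. *)
pose W := (1 + lambda * T) `^ (p - 1).
have W1 : 1 <= W.
  by rewrite /W -[leLHS](powRr0 (1 + lambda * T)) ler_powR ?base_ge1 ?(ltW hT)//
    subr_ge0 ltW.
have IW u : 0 <= u -> u <= T -> I u <= W * u.
  move=> u0 uT; have dI s : 0 <= s -> s <= u ->
    is_derive s 1 I ((1 + lambda * s) `^ (p - 1)).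
    by move=> s0 _; exact: is_derive_effort.
  have WI s : 0 <= s -> s <= u -> `|(1 + lambda * s) `^ (p - 1)| <= W.
    move=> s0 su; rewrite ger0_norm ?powR_ge0//; apply: ge0_ler_powR;
      rewrite ?nnegrE ?subr_ge0 ?(ltW p1)//.
    - exact/ltW/base_gt0.
    - exact/ltW/base_gt0/ltW.
    - by rewrite lerD2l ler_pM2l// (le_trans su).
  have := is_derive_lipschitz dI WI (lexx 0) u0 (lexx u).
  by rewrite effort0 !subr0; apply: le_trans; rewrite ler_norm.
have I0T : 0 < I T by rewrite effort_gt0.
(* The primitive [Q] is controlled only before [T], hence the separate value at [T]. *)
exists (fun t => if t < T then theta - D t else theta); last by rewrite ltxx.
have dx t : 0 <= t -> t < T -> is_derive t 1 (fun t => if t < T then theta - D t else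
  theta) (D t / I (T - t)).
  move=> t0 tT; apply: (@near_eq_is_derive _ _ _ (fun t => theta - D t)).
    by near=> s; rewrite ifT//; near: s; exact: lt_nbhsl.
  rewrite -[X in is_derive _ _ _ X]opprK; apply: is_derive_shiftf; apply: is_derive_oppf.
  by apply: dD => //; exact: lt_le_trans t0.
have dxV t : 0 <= t -> t < T -> `|D t / I (T - t)| <= V.
  move=> t0 tT; have v0 : 0 <= D t / I (T - t) by rewrite divr_ge0// ltW// I0.
  by rewrite (ger0_norm v0) ler_pdivrMr ?I0// DV.
split.
- apply: (@lipschitz_absolutely_continuous _ _ _ _ (V * W)) => u v u0.
  rewrite le_eqVlt => /predU1P[<- _|uv vT]; first by rewrite !subrr normr0 mulr0.
  have uT := lt_le_trans uv vT.
  have VW : V <= V * W by rewrite ler_peMr.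
  move: vT; rewrite le_eqVlt => /predU1P[->|vT].
    rewrite ltxx uT opprB addrC subrK ger0_norm ?D0//.
    rewrite (le_trans (DV _ u0 uT))// -mulrA ler_wpM2l// IW ?subr_ge0 ?(ltW uT)//.
    by rewrite lerBlDr lerDl.
  have dx' s : u <= s -> s <= v -> is_derive s 1 _ (D s / I (T - s)) :=
    fun us sv => dx s (le_trans u0 us) (le_lt_trans sv vT).
  have dxV' s : u <= s -> s <= v -> `|D s / I (T - s)| <= V :=
    fun us sv => dxV s (le_trans u0 us) (le_lt_trans sv vT).
  have le := is_derive_lipschitz dx' dxV' (lexx u) (ltW uv) (lexx v).
  by rewrite (le_trans le)// ler_wpM2r// subr_ge0 ltW.
- by rewrite hT /D subrr mulr0 oppr0 expR0 mulr1 subrr.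
have F := ae_filter_ringOfSetsType leb; apply: filterS (ae_neq 0) => t _.
rewrite in_itv/= => /andP[t0 tT].
exists (D t / I (T - t)); first exact: dx.
rewrite tT; have xD : theta - (theta - D t) = D t by rewrite opprB subrKC.
rewrite -[in X in chosen_speed _ _ _ _ _ _ _ _ X]xD.
apply: chosen_speed_work => //; first by rewrite gerBl.
by rewrite xD price_le_prize// -(fT_urgency dQ)// fle.
Unshelve. all: by end_near. Qed.

End Trajectory.

(** * The critical horizon *)

Section CriticalHorizon.
Context {R : realType}.
Variables (alpha lambda mu : R).
Hypotheses (halpha : 1 < alpha) (hlambda : 0 < lambda) (hmu : 0 < mu).
Implicit Types (s t u v w x : R).
Local Notation leb := (@lebesgue_measure R).
Local Notation p := (expo alpha lambda mu).
Local Notation I := (effort alpha lambda mu).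
Local Notation Tc := (Tcrit alpha lambda mu).

Let a1 : 0 < alpha - 1. Proof. by rewrite subr_gt0. Qed.
Let al0 : 0 < alpha. Proof. exact: lt_trans halpha. Qed.
Let p1 : 1 < p. Proof. exact: expo_gt1. Qed.
Let p0 : 0 < p. Proof. exact: lt_trans p1. Qed.
Let lp0 : 0 < lambda * p. Proof. by rewrite mulr_gt0. Qed.
Let mlE : mu / lambda = (alpha - 1) * (p - 1). Proof. exact: expoE. Qed.

(* The equation defining [x0] is [crit (x0 `^ (alpha - 1)) = 0]. *)
Definition crit w : R := (alpha - 1) * w `^ p - alpha * p * w + mu / lambda.

Let crit1 : crit 1 < 0.
Proof. by rewrite /crit powR1 mlE; have := p0; lra. Qed.

Let crit_tangent v w : 1 <= v -> 1 <= w ->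
  crit v + ((alpha - 1) * (p * v `^ (p - 1)) - alpha * p) * (w - v) <= crit w.
Proof.
move=> v1 w1; have := @powR_ge_tangent _ p v w p1 (le_trans ler01 v1) (le_trans ler01 w1).
rewrite -(ler_pM2l a1) /crit; lra.
Qed.

Lemma crit_root : exists2 w, 1 < w & crit w = 0.
Proof.
(* The point where the first two terms of [crit] cancel, leaving [mu / lambda > 0]. *)
pose W := (alpha * p / (alpha - 1)) `^ (p - 1)^-1.
have p10 : 0 < p - 1 by rewrite subr_gt0.
have base1 : 1 < alpha * p / (alpha - 1).
  rewrite ltr_pdivlMr// mul1r (@lt_trans _ _ alpha) ?gtrBl//.
  by rewrite ltr_pMr.
have W1 : 1 < W by rewrite powR_gt1// invr_gt0.
have critW : 0 < crit W.
  rewrite /crit -(mulr_powRB1 (ltW (lt_trans ltr01 W1)) p0).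
  rewrite [W `^ (p - 1)](_ : _ = alpha * p / (alpha - 1)); last first.
    rewrite /W -powRrM mulVf ?gt_eqF// powRr1// ltW// (lt_trans ltr01)//.
  have -> : (alpha - 1) * (W * (alpha * p / (alpha - 1))) = alpha * p * W.
    by field; rewrite gt_eqF.
  by rewrite subrr add0r divr_gt0.
have cc : {within `[1, W], continuous crit}.
  apply: continuous_in_subspaceT => w; rewrite inE/= in_itv/= => /andP[w1 _].
  have w0 : 0 < w by exact: lt_le_trans w1.
  have d := is_derive_addf (is_derive_scalef (alpha - 1) (is_derive1_powR p w0))
    (is_derive_affine (mu / lambda) (- (alpha * p)) w).
  have -> : crit = fun y => (alpha - 1) * y `^ p + (mu / lambda + - (alpha * p) * y).
    by apply/funext => y; rewrite /crit; ring.
  exact: is_derive_continuous d.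
have [|c + c0] := @IVT _ crit 1 W 0 (ltW W1) cc.
  by rewrite ge_min le_max (ltW crit1) (ltW critW) orbT.
rewrite in_itv/= => /andP[c1 _]; exists c => //.
by rewrite lt_neqAle c1 andbT; apply: contraPneq c0 => <-; apply/eqP; rewrite lt_eqF.
Qed.

Definition root : R := x0 alpha lambda mu `^ (alpha - 1).

Lemma root_spec : 1 < root /\ crit root = 0.
Proof.
have critE x : x0_equation alpha lambda mu x <-> crit (x `^ (alpha - 1)) = 0.
  rewrite /x0_equation /crit -powRrM -/p (_ : (alpha - 1) * p = mu / lambda + alpha - 1) //.
  by rewrite mlE; ring.
have [w w1 w0] := crit_root.
have [x1 /critE eq] : [set x | 1 < x /\ x0_equation alpha lambda mu x] (x0 alpha lambda mu).
  apply: getPex; exists (w `^ (alpha - 1)^-1); split.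
    by rewrite powR_gt1// invr_gt0.
  by apply/critE; rewrite -powRrM mulVf ?gt_eqF// powRr1// ltW// (lt_trans ltr01).
by split=> //; rewrite powR_gt1.
Qed.

Let r1 : 1 < root. Proof. by have [] := root_spec. Qed.
Let r0 : 0 < root. Proof. exact: lt_trans r1. Qed.

(* As [crit] is convex and negative at 1, it changes sign only once beyond 1. *)
Lemma crit_le0 w : 1 <= w -> w <= root -> crit w <= 0.
Proof.
move=> w1 wr; rewrite leNgt; apply/negP => cw.
have [c H] : exists c, forall v, 1 <= v -> crit w + c * (v - w) <= crit v.
  exists ((alpha - 1) * (p * w `^ (p - 1)) - alpha * p) => v v1.
  exact: crit_tangent.
have h1 := H _ (lexx 1); have := H _ (ltW r1); have [_ ->] := root_spec => h2.
have c0 : c <= 0.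
  rewrite leNgt; apply/negP => c0.
  have : 0 <= c * (root - w) by rewrite mulr_ge0 ?subr_ge0// ltW.
  by lra.
have : 0 <= c * (1 - w) by rewrite mulr_le0// subr_le0.
by move: crit1; lra.
Qed.

Lemma crit_ge0 w : root <= w -> 0 <= crit w.
Proof.
move=> rw; have w1 : 1 <= w by rewrite (le_trans (ltW r1)).
have [_ cr] := root_spec; pose c := (alpha - 1) * (p * root `^ (p - 1)) - alpha * p.
have h1 := crit_tangent (ltW r1) (lexx 1); have := crit_tangent (ltW r1) w1.
rewrite -/c cr in h1 *.
have c0 : 0 <= c.
  rewrite leNgt; apply/negP => c0.
  have : 0 <= c * (1 - root) by apply: mulr_le0; [exact: ltW|rewrite subr_le0 ltW].
  by move: crit1; lra.
have : 0 <= c * (w - root) by rewrite mulr_ge0// subr_ge0.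
by lra.
Qed.

Lemma Tcrit_gt0 : 0 < Tc.
Proof. by rewrite /Tcrit divr_gt0// subr_gt0. Qed.

Lemma base_Tcrit : 1 + lambda * Tc = root.
Proof. by rewrite /Tcrit -/root mulrC divfK ?gt_eqF// subrKC. Qed.

Section Peak.
Variable T : R.
Hypothesis hT : 0 < T.

Let b t : R := 1 + lambda * (T - t).
Let q t : R := (b t `^ p - 1)^-1.
Let I0 t : t < T -> 0 < I (T - t). Proof. by move=> tT; rewrite effort_gt0// subr_gt0. Qed.
Let b0 t : t <= T -> 0 < b t. Proof. by move=> tT; rewrite base_gt0// subr_ge0. Qed.

Definition peak : R := if T <= Tc then 0 else T - Tc.

Lemma peak_itv : 0 <= peak /\ peak < T.
Proof.
rewrite /peak; case: (leP T Tc) => TT; first by rewrite lexx.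
by rewrite subr_ge0 ltW// ltrBlDr ltrDl Tcrit_gt0.
Qed.

(* The logarithmic derivative of [fT] has the sign of [crit (1 + lambda (T - t))]. *)
Lemma fT_le_peak t : 0 <= t -> t < T ->
  fT alpha lambda mu T t <= fT alpha lambda mu T peak.
Proof.
move=> t0 tT; have [pk0 pkT] := peak_itv.
have [Q dQ] := working_rate_primitive halpha hlambda hmu T.
pose L s := - (alpha * (lambda * p)) * Q s + (- (alpha - 1) * ln (I (T - s)) + mu /
  lambda * ln (b s)).
have fE s : 0 <= s -> s < T -> fT alpha lambda mu T s = expR (L s + alpha * (lambda * p)
  * Q 0).
  move=> s0 sT; have := fT_urgency halpha hlambda hmu ler01 dQ s0 sT.
  rewrite powR1 !mul1r => ->; rewrite /urgency /powR !gt_eqF ?expR_gt0 ?invr_gt0 ?I0 ?b0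
    ?(ltW sT)//.
  rewrite expRK lnV ?posrE ?I0// -!expRD /L -/(b s); congr expR; ring.
have dL s : 0 <= s -> s < T -> is_derive s 1 L (crit (b s) / (p * b s * I (T - s))).
  move=> s0 sT.
  have d1 : is_derive s 1 (fun s => - (alpha * (lambda * p)) * Q s) (- (alpha * (lambda *
    p)) * q s).
    by apply: is_derive_scalef; apply: dQ => //; exact: lt_le_trans s0.
  have d2 : is_derive s 1 (fun s => ln (I (T - s))) (- ((I (T - s))^-1 * b s `^ (p - 1))).
    apply: (@is_derive_reflect _ (fun u => ln (I u))); apply: is_derive_compf.
      exact: is_derive1_ln (I0 sT).
    by apply: is_derive_effort => //; rewrite subr_ge0 ltW.
  have d3 : is_derive s 1 (fun s => ln (b s)) (- ((b s)^-1 * lambda)).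
    have e := @is_derive_compf _ (@ln R) (fun u => 1 + lambda * u) (T - s) _ _
      (is_derive1_ln (b0 (ltW sT))) (is_derive_affine 1 lambda (T - s)).
    exact: (@is_derive_reflect _ (fun u => ln (1 + lambda * u)) T s _ e).
  have := is_derive_addf d1 (is_derive_addf (is_derive_scalef (- (alpha - 1)) d2)
    (is_derive_scalef (mu / lambda) d3)).
  congr is_derive.
  have bs := b0 (ltW sT); have Is := I0 sT.
  have qI : q s = (lambda * p * I (T - s))^-1 by rewrite /q /effort mulrC divfK ?gt_eqF.
  have bI : b s `^ p = lambda * p * I (T - s) + 1 by rewrite /effort -/(b s) mulrC divfK
    ?subrK ?gt_eqF.
  have bI' : b s `^ (p - 1) = (lambda * p * I (T - s) + 1) / b s.
    by rewrite -bI -(mulr_powRB1 (ltW bs) p0) mulrAC divff ?mul1r ?gt_eqF.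
  rewrite qI bI' /crit bI mlE; field.
  by rewrite !gt_eqF.
rewrite (fE _ t0 tT) (fE _ pk0 pkT) ler_expR lerD2r.
have den s : s < T -> 0 <= (p * b s * I (T - s))^-1.
  by move=> sT; rewrite invr_ge0; apply/ltW/mulr_gt0/I0 => //; apply/mulr_gt0/b0/ltW.
have [tp|pt|->//] := ltgtP t peak.
- have [s us sv|s /andP[ts sp] E] := is_derive_MVT tp (f :=
  fun s => crit (b s) / (p * b s * I (T - s))) (F := L).
    by apply: dL; [exact: le_trans us|exact: le_lt_trans pkT].
  rewrite -subr_ge0 E mulr_ge0 ?subr_ge0 ?(ltW tp)// mulr_ge0 ?den ?(lt_trans sp)//.
  apply: crit_ge0; rewrite -base_Tcrit lerD2l ler_pM2l//.
  move: sp tp; rewrite /peak; case: ifP => [_ _|_]; first by rewrite ltNge t0.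
  by move=> sp _; lra.
- have [s us sv|s /andP[ps st] E] := is_derive_MVT pt (f :=
  fun s => crit (b s) / (p * b s * I (T - s))) (F := L).
    by apply: dL; [exact: le_trans us|exact: le_lt_trans tT].
  have sT := lt_trans st tT.
  rewrite -subr_le0 E mulr_le0_ge0 ?subr_ge0 ?(ltW pt)// mulr_le0_ge0 ?den//.
  apply: crit_le0; first by rewrite base_ge1// subr_ge0 ltW.
  rewrite -base_Tcrit lerD2l ler_pM2l//.
  by move: ps; rewrite /peak; case: (leP T Tc) => TT ps; lra.
Qed.

Lemma F_peak : F alpha lambda mu T = fT alpha lambda mu T peak `^ (- (alpha - 1)^-1).
Proof. by rewrite /F gt_eqF// /peak; case: ifP. Qed.

Lemma fT_gt0 t : 0 <= t -> t < T -> 0 < fT alpha lambda mu T t.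
Proof.
move=> t0 tT; have [Q dQ] := working_rate_primitive halpha hlambda hmu T.
have := fT_urgency halpha hlambda hmu ler01 dQ t0 tT.
rewrite powR1 !mul1r => ->; rewrite mulr_gt0 ?powR_gt0 ?expR_gt0//.
exact: urgency_gt0.
Qed.

Lemma F_gt0 : 0 < F alpha lambda mu T.
Proof. by rewrite F_peak powR_gt0// fT_gt0//; have [] := peak_itv. Qed.

Lemma feasible_goal rew theta : 0 <= rew -> 0 <= theta ->
  (forall t, 0 <= t -> t < T -> theta `^ alpha * fT alpha lambda mu T t <= rew) <->
  theta <= rew `^ alpha^-1 * F alpha lambda mu T `^ ((alpha - 1) / alpha).
Proof.
move=> r0' th0; have [pk0 pkT] := peak_itv; have f0 := fT_gt0 pk0 pkT.
have E : rew `^ alpha^-1 * F alpha lambda mu T `^ ((alpha - 1) / alpha) =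
    (rew / fT alpha lambda mu T peak) `^ alpha^-1.
  rewrite powRM ?invr_ge0 ?(ltW f0)//; congr (_ * _).
  rewrite F_peak -powRrM -(powR_inv1 (ltW f0)) -powRrM; congr (_ `^ _).
  by field; rewrite !gt_eqF.
have E2 : (theta <= (rew / fT alpha lambda mu T peak) `^ alpha^-1) =
    (theta `^ alpha * fT alpha lambda mu T peak <= rew).
  rewrite -ler_pdivlMr//.
  have y0 : 0 <= rew / fT alpha lambda mu T peak by rewrite divr_ge0// ltW.
  have zE : ((rew / fT alpha lambda mu T peak) `^ alpha^-1) `^ alpha = rew / fT alpha
    lambda mu T peak.
    by rewrite -powRrM mulVf ?gt_eqF// powRr1.
  rewrite -[in RHS]zE; apply/idP/idP => le.
    by apply: ge0_ler_powR; rewrite ?nnegrE ?powR_ge0// ltW.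
  rewrite leNgt; apply/negP => lt; move: le; rewrite leNgt => /negP; apply.
  by apply: gt0_ltr_powR; rewrite ?nnegrE ?powR_ge0.
rewrite E E2; split => [|le t t0 tT]; first exact.
by apply: (le_trans _ le); apply: ler_wpM2l; [exact: powR_ge0|exact: fT_le_peak].
Qed.

End Peak.

End CriticalHorizon.

(** * Strict concavity of [F] *)

Lemma strict_tangent (R : realType) (G H : R -> R) (lo : R) :
  (forall u, lo <= u -> is_derive u 1 G (H u)) ->
  (forall u v, lo <= u -> u < v -> H v < H u) ->
  forall u v, lo <= u -> lo <= v -> v != u -> G v < G u + H u * (v - u).
Proof.
move=> dG Hd u v lu lv; rewrite neq_lt => /orP[vu|uv].
- have [s vs su|c /andP[vc cu] E] := is_derive_MVT vu (F := G) (f := H).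
    by apply: dG; exact: le_trans vs.
  have : H u * (u - v) < H c * (u - v) by rewrite ltr_pM2r ?subr_gt0// Hd//
    (le_trans lv)// ltW.
  by rewrite -E; lra.
- have [s us sv|c /andP[uc cv] E] := is_derive_MVT uv (F := G) (f := H).
    by apply: dG; exact: le_trans us.
  have : H c * (v - u) < H u * (v - u) by rewrite ltr_pM2r ?subr_gt0// Hd.
  by rewrite -E; lra.
Qed.

Section StrictConcavity.
Context {R : realType}.
Variables (alpha lambda mu : R).
Hypotheses (halpha : 1 < alpha) (hlambda : 0 < lambda) (hmu : 0 < mu).
Implicit Types (s t u v w x : R).
Local Notation leb := (@lebesgue_measure R).
Local Notation p := (expo alpha lambda mu).
Local Notation I := (effort alpha lambda mu).
Local Notation Tc := (Tcrit alpha lambda mu).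
Local Notation F := (F alpha lambda mu).
Local Notation root := (root alpha lambda mu).

Let a1 : 0 < alpha - 1. Proof. by rewrite subr_gt0. Qed.
Let al0 : 0 < alpha. Proof. exact: lt_trans halpha. Qed.
Let p1 : 1 < p. Proof. exact: expo_gt1. Qed.
Let p0 : 0 < p. Proof. exact: lt_trans p1. Qed.
Let lp0 : 0 < lambda * p. Proof. by rewrite mulr_gt0. Qed.
Let mlE : mu / lambda = (alpha - 1) * (p - 1). Proof. exact: expoE. Qed.
Let r1 : 1 < root. Proof. by have [] := root_spec halpha hlambda hmu. Qed.
Let r0 : 0 < root. Proof. exact: lt_trans r1. Qed.
Let Tc0 : 0 < Tc. Proof. exact: Tcrit_gt0. Qed.

Let B u : R := 1 + lambda * u.
Let B0 u : 0 <= u -> 0 < B u. Proof. exact: base_gt0. Qed.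
Let B1 u : 0 < u -> 1 < B u. Proof. exact: base_gt1. Qed.
Let Bp1 u : 0 < u -> 0 < B u `^ p - 1.
Proof. by move=> u0; rewrite subr_gt0 powR_gt1// B1. Qed.
Let BTc : B Tc = root. Proof. exact: base_Tcrit. Qed.

(* For short stages working is worthwhile from the start: [F] is [early]; from
   [Tcrit] on it is [late], which continues [early] with the same derivative. *)
Let early u : R := (B u - B u `^ (1 - p)) / (lambda * p).
Let early' u : R := (1 + (p - 1) * B u `^ (- p)) / p.

Let is_derive_early u : 0 <= u -> is_derive u 1 early (early' u).
Proof.
move=> u0.
have d := is_derive_scalef (lambda * p)^-1 (is_derive_addf (is_derive_affine 1 lambda u)
  (is_derive_oppf (is_derive_base_powR (1 - p) (B0 u0)))).
have -> : early = fun y => (lambda * p)^-1 * (1 + lambda * y + - (1 + lambda * y) `^ (1 -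
  p)).
  by apply/funext => y; rewrite /early mulrC.
apply: is_derive_eq d _; rewrite /early' -/(B u).
have -> : 1 - p - 1 = - p by ring.
by field; rewrite !gt_eqF.
Qed.

Let early'_decreasing u v : 0 <= u -> u < v -> early' v < early' u.
Proof.
move=> u0 uv; have v0 := le_lt_trans u0 uv.
rewrite ltr_pM2r ?invr_gt0// ltrD2l ltr_pM2l ?subr_gt0//.
rewrite !powRN ltf_pV2 ?posrE ?powR_gt0 ?B0 ?(ltW v0)//.
apply: gt0_ltr_powR; rewrite ?nnegrE ?(ltW (B0 _)) ?(ltW v0)//.
by rewrite ltrD2l ltr_pM2l.
Qed.

Let fT0 u : 0 < u -> fT alpha lambda mu u 0 = (I u)^-1 `^ (alpha - 1) * B u `^ (mu /
  lambda).
Proof.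
move=> u0; have [Q dQ] := working_rate_primitive halpha hlambda hmu u.
have := fT_urgency halpha hlambda hmu ler01 dQ (lexx 0) u0.
rewrite powR1 !mul1r => ->; rewrite subrr mulr0 oppr0 expR0 powR1 mul1r.
by rewrite /urgency subr0.
Qed.

Let urgency_powN u : 0 < u ->
  ((I u)^-1 `^ (alpha - 1) * B u `^ (mu / lambda)) `^ (- (alpha - 1)^-1) = early u.
Proof.
move=> u0; have Iu := effort_gt0 halpha hlambda hmu u0.
rewrite powRM ?powR_ge0// -!powRrM.
have -> : (alpha - 1) * - (alpha - 1)^-1 = -1 by field; rewrite gt_eqF.
have -> : mu / lambda * - (alpha - 1)^-1 = 1 - p by rewrite mlE; field; rewrite gt_eqF.
rewrite powR_inv1 ?invr_ge0 ?(ltW Iu)// invrK /effort /early -/(B u).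
rewrite mulrAC mulrBl mul1r; congr ((_ - _) / _).
rewrite -powRD; last by apply/implyP => _; rewrite lt0r_neq0// B0// ltW.
by rewrite subrKC powRr1// ltW// B0// ltW.
Qed.

Let earlyE u : 0 < u -> F1 alpha lambda mu u = early u.
Proof. by move=> u0; rewrite /F1 fT0// urgency_powN. Qed.

(** The factor alpha lambda p in the exponent of f_T, after the power -1 / (alpha - 1) that defines
    [F2]. *)
Let k : R := alpha * (lambda * p) / (alpha - 1).

Let dB u : 0 <= u -> is_derive u 1 (fun u => B u `^ p - 1) (lambda * p * B u `^ (p - 1)).
Proof.
move=> u0; have := is_derive_shiftf (-1) (is_derive_base_powR p (B0 u0)).
by congr is_derive; apply/funext => s; rewrite addrC.
Qed.

Let k0 : 0 < k. Proof. by rewrite divr_gt0// mulr_gt0. Qed.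

Let late_primitive : exists P : R -> R, forall u,
  Tc <= u -> is_derive u 1 P (B u `^ p - 1)^-1.
Proof.
have cq s : 0 < s -> {for s, continuous (fun u => (B u `^ p - 1)^-1)}.
  move=> s0; apply: (@continuousV _ _ (fun u => B u `^ p - 1));
    first by rewrite gt_eqF ?Bp1.
  exact: is_derive_continuous (dB (ltW s0)).
(* The base point avoids the singularity at 0 and lies strictly below [Tc], so that the primitive is
   differentiable at [Tc] too. *)
exists (fun u => \int[leb]_(s in `[Tc / 2, u]) (B s `^ p - 1)^-1) => u Tu.
have T2 : 0 < Tc / 2 by rewrite divr_gt0.
have iq : leb.-integrable `[Tc / 2, u + 1] (EFin \o (fun u => (B u `^ p - 1)^-1)).
  by apply: continuous_segment_integrable => s sT _; apply: cq; exact: lt_le_trans sT.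
have Tu2 : Tc / 2 < u by rewrite (lt_le_trans _ Tu)// ltr_pdivrMr// ltr_pMr// ltr1n.
have u0 : 0 < u by exact: lt_le_trans Tu.
have u1 : u < u + 1 by rewrite ltrDl.
have [dq <-] := continuous_FTC1_closed u1 iq Tu2 (cq _ u0).
by rewrite derive1E; apply: DeriveDef.
Qed.

Let root_powR : (alpha - 1) * root `^ p = alpha * p * root - (alpha - 1) * (p - 1).
Proof. by have [_] := root_spec halpha hlambda hmu; rewrite /crit mlE; lra. Qed.

Section Late.
Variable P : R -> R.
Hypothesis dP : forall u, Tc <= u -> is_derive u 1 P (B u `^ p - 1)^-1.

Let late u : R := early Tc * expR (k * (P u - P Tc)).
Let late' u : R := late u * (k * (B u `^ p - 1)^-1).

Let early_Tc : early Tc = root * (root `^ p - 1) / (root `^ p * (lambda * p)).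
Proof.
rewrite /early BTc powRB; last by apply/implyP => _; exact: lt0r_neq0.
rewrite powRr1 ?(ltW r0)//; have : root `^ p != 0 by apply: lt0r_neq0; exact: powR_gt0.
by move: (root `^ p) => X X0; field; rewrite X0 !gt_eqF.
Qed.

Let late_gt0 u : 0 < late u.
Proof.
apply: mulr_gt0; last exact: expR_gt0.
rewrite early_Tc; apply: divr_gt0; apply: mulr_gt0 => //; last exact: powR_gt0.
by rewrite subr_gt0 powR_gt1.
Qed.

Let is_derive_late u : Tc <= u -> is_derive u 1 late (late' u).
Proof.
move=> Tu; have d := is_derive_scalef k (is_derive_shiftf (- P Tc) (dP Tu)).
have := is_derive_scalef (early Tc) (@is_derive_compf _ expR _ u _ _ (is_derive_expR _) d).
have -> : (fun y => early Tc * expR (k * (- P Tc + P y))) = late.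
  by apply/funext => y; rewrite /late [_ + P y]addrC.
by congr is_derive; rewrite /late' /late [- P Tc + _]addrC; ring.
Qed.

Let is_derive_late' u : Tc <= u -> is_derive u 1 late'
  (late u * k * (B u `^ p - 1)^-1 ^+ 2 * (k - lambda * p * B u `^ (p - 1))).
Proof.
move=> Tu; have u0 : 0 < u by exact: lt_le_trans Tu.
have y0 : B u `^ p - 1 != 0 by rewrite gt_eqF ?Bp1.
have dV := @is_deriveV _ (fun u => B u `^ p - 1) u _ 1 y0 (dB (ltW u0)).
have := is_derive_mulf (is_derive_late Tu) (is_derive_scalef k dV).
by congr is_derive; rewrite /late' /GRing.scale/=; field.
Qed.

Let late'_decreasing u v : Tc <= u -> u < v -> late' v < late' u.
Proof.
move=> Tu uv.
have [s us sv|c /andP[uc cv] E] := is_derive_MVT uv (F := late')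
    (f := fun u => late u * k * (B u `^ p - 1)^-1 ^+ 2 * (k - lambda * p * B u `^ (p - 1))).
  by apply: is_derive_late'; exact: le_trans us.
rewrite -subr_lt0 E pmulr_llt0 ?subr_gt0// pmulr_rlt0; last first.
  apply: mulr_gt0; first by apply: mulr_gt0.
  apply: exprn_gt0; rewrite invr_gt0; apply: Bp1.
  exact: lt_trans (lt_le_trans Tc0 Tu) uc.
have Bc : root `^ (p - 1) <= B c `^ (p - 1).
  have rB : root <= B c by rewrite -BTc lerD2l ler_pM2l// (le_trans Tu)// ltW.
  by apply: ge0_ler_powR; rewrite ?nnegrE ?subr_ge0 ?(ltW p1)// ?(ltW r0)//
    (le_trans (ltW r0)).
(* By the equation of the root, (alpha - 1) root^p - alpha root = (p - 1) (alpha (root - 1) + 1) >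
   0. This makes the second derivative of [late] negative from [Tc] on. *)
have rr : alpha < (alpha - 1) * root `^ (p - 1).
  rewrite -(ltr_pM2r r0); have := root_powR; rewrite -(mulr_powRB1 (ltW r0) p0).
  have h1 : 0 < (p - 1) * (root - 1) by rewrite mulr_gt0 ?subr_gt0.
  have h2 : 0 < alpha * ((p - 1) * (root - 1)) by rewrite mulr_gt0.
  by move: (root `^ _) => X; move: p1; lra.
have h : alpha < (alpha - 1) * B c `^ (p - 1) by rewrite (lt_le_trans rr)// ler_pM2l.
have : lambda * p * alpha < lambda * p * ((alpha - 1) * B c `^ (p - 1)) by rewrite ltr_pM2l.
by rewrite subr_lt0 /k ltr_pdivrMr//; lra.
Qed.

Let late_Tc : late Tc = early Tc.
Proof. by rewrite /late subrr mulr0 expR0 mulr1. Qed.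

(* This is where the equation defining [x0] comes from. *)
Let late'_Tc : late' Tc = early' Tc.
Proof.
rewrite /late' late_Tc early_Tc /early' BTc powRN /k.
have X1 : 0 < root `^ p - 1 by rewrite subr_gt0 powR_gt1.
have X0 : 0 < root `^ p by rewrite powR_gt0.
have E : (p - 1) = (alpha * p * root - (alpha - 1) * root `^ p) / (alpha - 1).
  by rewrite root_powR; field; rewrite gt_eqF.
rewrite E; move: X1 X0; move: (root `^ p) => X X1 X0.
by field; rewrite !gt_eqF.
Qed.

Let lateE u : Tc < u -> F2 alpha lambda mu u = late u.
Proof.
move=> Tu; have u0 : 0 < u by exact: lt_trans Tu.
have t0 : 0 < u - Tc by rewrite subr_gt0.
have tu : u - Tc < u by rewrite ltrBlDr ltrDl.
have [Q dQ] := working_rate_primitive halpha hlambda hmu u.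
have QP : Q (u - Tc) - Q 0 = P u - P Tc.
  (* The change of variables from elapsed to remaining time in the integral, expressed as the
     constancy of this sum. *)
  have d s : 0 <= s -> s <= u - Tc -> is_derive s 1 (fun s => Q s + P (u - s)) 0.
    move=> s0 st; have Ts : Tc <= u - s by lra.
    have d1 : is_derive s 1 Q (B (u - s) `^ p - 1)^-1.
      by apply: dQ; [exact: lt_le_trans s0|exact: le_lt_trans tu].
    by have := is_derive_addf d1 (is_derive_reflect (dP Ts)); rewrite subrr.
  have [c _] := is_derive_MVT t0 d (f := fun=> 0); rewrite mul0r subKr subr0.
  by lra.
have := fT_urgency halpha hlambda hmu ler01 dQ (ltW t0) tu.
rewrite powR1 !mul1r /F2 => ->;
  rewrite QP -expRM /urgency subKr powRM ?expR_ge0 ?mulr_ge0 ?powR_ge0//.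
rewrite urgency_powN// -expRM /late mulrC; congr (_ * expR _).
by rewrite /k; field; rewrite gt_eqF.
Qed.

Let FE_early u : 0 <= u -> u <= Tc -> F u = early u.
Proof.
rewrite /Defs.F le_eqVlt => /predU1P[<- _|u0 uT].
  by rewrite eqxx /early /B mulr0 addr0 powR1 subrr mul0r.
by rewrite gt_eqF// uT earlyE.
Qed.

Let FE_late u : Tc <= u -> F u = late u.
Proof.
rewrite le_eqVlt => /predU1P[<-|Tu]; first by rewrite FE_early ?late_Tc// ltW.
by rewrite /Defs.F gt_eqF ?(lt_trans _ Tu)// leNgt Tu /= lateE.
Qed.

(** Each piece lies below its own tangents. If [u] and [a] are on different sides of [Tc], the
    tangent at [Tc], common to both pieces, is interposed, and the monotonicity of the slopes
    concludes. *)
Lemma F_lt_tangent_late a : 0 < a ->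
  exists c, forall u, 0 <= u -> u != a -> F u < F a + c * (u - a).
Proof.
move=> a0; have te := strict_tangent is_derive_early early'_decreasing.
have tl := strict_tangent is_derive_late late'_decreasing.
have tT u : 0 <= u -> u <= Tc -> early u <= early Tc + early' Tc * (u - Tc).
  move=> u0; rewrite le_eqVlt => /predU1P[->|uT]; first by rewrite subrr mulr0 addr0.
  by apply/ltW/te; rewrite ?(ltW Tc0)// lt_eqF.
have [aT|Ta] := leP a Tc.
- exists (early' a) => u u0 ua; rewrite (FE_early (ltW a0) aT).
  have [uT|Tu] := leP u Tc; first by rewrite FE_early// te// ltW.
  rewrite FE_late ?(ltW Tu)//.
  have h1 := tl _ _ (lexx Tc) (ltW Tu) (negbT (gt_eqF Tu)).
  have [aeT|aneT] := eqVneq a Tc; first by rewrite aeT -late_Tc -late'_Tc.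
  have aT' : a < Tc by rewrite lt_neqAle aneT.
  have h2 := te _ _ (ltW a0) (ltW Tc0) (negbT (gt_eqF aT')).
  have h3 : early' Tc * (u - Tc) < early' a * (u - Tc).
    by rewrite ltr_pM2r ?subr_gt0// early'_decreasing// ltW.
  by move: h1; rewrite late_Tc late'_Tc; lra.
exists (late' a) => u u0 ua; rewrite (FE_late (ltW Ta)).
have [uT|Tu] := leP u Tc; last by rewrite FE_late ?(ltW Tu)// tl// ltW.
rewrite FE_early//.
have h1 := tT _ u0 uT.
have h2 := tl _ _ (ltW Ta) (lexx Tc) (negbT (lt_eqF Ta)).
have h3 : early' Tc * (u - Tc) <= late' a * (u - Tc).
  rewrite -late'_Tc ler_wnM2r ?subr_le0// ltW// late'_decreasing//.
by move: h2; rewrite late_Tc; lra.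
Qed.

End Late.

Lemma F_lt_tangent a : 0 < a ->
  exists c, forall u, 0 <= u -> u != a -> F u < F a + c * (u - a).
Proof. by move=> a0; have [P dP] := late_primitive; exact: (F_lt_tangent_late dP a0). Qed.

End StrictConcavity.

(** * Schedules *)

Lemma powR_amgm (R : realType) (c a b : R) : 0 < c < 1 -> 0 <= a -> 0 <= b ->
  a `^ c * b `^ (1 - c) <= c * a + (1 - c) * b.
Proof.
move=> /andP[c0 c1] a0; rewrite le_eqVlt => /predU1P[<-|b0].
  by rewrite powR0 ?mulr0 ?addr0 ?mulr_ge0 ?(ltW c0)// gt_eqF ?subr_gt0.
have -> : a `^ c * b `^ (1 - c) = b * (a / b) `^ c.
  have -> : b `^ (1 - c) = b / b `^ c.
    by rewrite powRB ?powRr1 ?(ltW b0)//; apply/implyP => _; rewrite gt_eqF.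
  have -> : (a / b) `^ c = a `^ c / b `^ c.
    rewrite powRM ?invr_ge0 ?(ltW b0)//; congr (_ * _).
    by rewrite -(powR_inv1 (ltW b0)) -powRrM mulN1r powRN.
  by ring.
have ab0 : 0 <= a / b by rewrite divr_ge0// ltW.
have : (a / b) `^ c <= 1 + c * (a / b - 1).
  have [->|ab1] := eqVneq (a / b) 1; first by rewrite powR1 subrr mulr0 addr0.
  by apply/ltW/powR_lt_mean => //; rewrite c0.
rewrite -(ler_pM2l b0) => le; apply: le_trans le _.
by rewrite le_eqVlt; apply/orP; left; apply/eqP; field; rewrite gt_eqF.
Qed.

Section Schedules.
Context {R : realType}.
Variables (alpha lambda mu : R).
Hypotheses (halpha : 1 < alpha) (hlambda : 0 < lambda) (hmu : 0 < mu).
Local Notation F := (F alpha lambda mu).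

Let al0 : 0 < alpha. Proof. exact: lt_trans halpha. Qed.

Definition best_goal (T rew : R) : R := rew `^ alpha^-1 * F T `^ ((alpha - 1) / alpha).

Lemma F_ge0 T : 0 <= F T.
Proof. by rewrite /F; case: ifP => // _; case: ifP => _; rewrite powR_ge0. Qed.

Lemma best_goal_ge0 T rew : 0 <= best_goal T rew.
Proof. by rewrite mulr_ge0 ?powR_ge0. Qed.

Lemma progress_le_best_goal T rew theta : 0 <= rew -> 0 <= theta ->
  final_progress alpha lambda mu T rew theta theta -> theta <= best_goal T rew.
Proof.
move=> r0 th0 [[_ ->]|[T0 [x [acx x0 dx] xT]]]; first exact: best_goal_ge0.
apply/(feasible_goal halpha hlambda hmu T0 r0 th0).
exact: (trajectory_bound halpha hlambda hmu r0 th0 acx (esym xT) dx x0).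
Qed.

Lemma best_goal_progress T rew : 0 < T -> 0 <= rew ->
  final_progress alpha lambda mu T rew (best_goal T rew) (best_goal T rew).
Proof.
move=> T0 r0; right; split=> //.
apply: (trajectory_exists halpha hlambda hmu T0 r0 (best_goal_ge0 _ _)).
by apply/(feasible_goal halpha hlambda hmu T0 r0 (best_goal_ge0 _ _)).
Qed.

(* Concavity of [F] and AM-GM bound each stage by a function affine in its
   horizon and reward, so that only the totals matter for the sum. *)
Lemma best_goal_majorant Tb Rb : 0 < Tb -> 0 < Rb -> exists c d : R,
  forall T rew, 0 <= T -> 0 <= rew ->
    let m := best_goal Tb Rb + c * (T - Tb) + d * (rew - Rb) in
    best_goal T rew <= m /\ (best_goal T rew = m -> T = Tb /\ rew = Rb).
Proof.
move=> Tb0 Rb0; have Fb0 := F_gt0 halpha hlambda hmu Tb0.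
have [e He] := F_lt_tangent halpha hlambda hmu Tb0.
pose a := alpha^-1; have a0 : 0 < a by rewrite invr_gt0.
have a1 : a < 1 by rewrite invf_lt1.
have aE : (alpha - 1) / alpha = 1 - a by rewrite mulrBl divff ?gt_eqF// mul1r.
pose K := best_goal Tb Rb.
have K0 : 0 < K by rewrite mulr_gt0 ?powR_gt0.
(* The coefficients of the tangent plane of [best_goal] at (Tb, Rb), with [e] as slope of [F] at
   [Tb]. *)
exists (K * ((1 - a) * (e / F Tb))), (K * (a / Rb)) => T rew T0 r0 /=.
rewrite -/K; pose r := rew / Rb; pose f := F T / F Tb.
have rr0 : 0 <= r by rewrite divr_ge0// ltW.
have f0 : 0 <= f by rewrite divr_ge0 ?F_ge0// ltW.
have -> : best_goal T rew = K * (r `^ a * f `^ (1 - a)).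
  have E1 : rew = Rb * r by rewrite mulrC divfK// gt_eqF.
  have E2 : F T = F Tb * f by rewrite mulrC divfK// gt_eqF.
  rewrite /K /best_goal aE E2 {1}E1.
  by rewrite (@powRM _ Rb r _ (ltW Rb0) rr0) (@powRM _ (F Tb) f _ (ltW Fb0) f0) mulrACA.
have -> : K + K * ((1 - a) * (e / F Tb)) * (T - Tb) + K * (a / Rb) * (rew - Rb) =
    K * (a * r + (1 - a) * (1 + e / F Tb * (T - Tb))).
  by rewrite /r; field; rewrite !gt_eqF.
have flt : T != Tb -> f < 1 + e / F Tb * (T - Tb).
  have -> : 1 + e / F Tb * (T - Tb) = (F Tb + e * (T - Tb)) / F Tb.
    by field; rewrite gt_eqF.
  by move=> TTb; rewrite ltr_pM2r ?invr_gt0//; exact: He.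
have fle : f <= 1 + e / F Tb * (T - Tb).
  have [TTb|/flt/ltW//] := eqVneq T Tb.
  by rewrite /f TTb subrr mulr0 addr0 divff// lt0r_neq0.
have amgm : r `^ a * f `^ (1 - a) <= a * r + (1 - a) * f by apply: powR_amgm => //;
  rewrite a0.
have a1' : 0 < 1 - a by rewrite subr_gt0.
split.
  rewrite ler_pM2l// (le_trans amgm)// lerD2l ler_pM2l//; exact: fle.
move=> /(mulfI (lt0r_neq0 K0)) E.
have TTb : T = Tb.
  apply/eqP/negPn/negP => /flt; rewrite -(ltr_pM2l a1'); lra.
split=> //; apply/eqP/negPn/negP => rRb.
have r1 : r != 1.
  by apply: contra_neq rRb => /(congr1 ( *%R^~ Rb)); rewrite divfK ?gt_eqF// mul1r.
have f1 : f = 1 by rewrite /f TTb divff// lt0r_neq0.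
have : r `^ a < 1 + a * (r - 1) by apply: powR_lt_mean; rewrite ?a0.
by move: E; rewrite f1 TTb subrr mulr0 addr0 powR1 mulr1; lra.
Qed.

End Schedules.

Theorem theorem11 (R : realType) (T rew alpha lambda mu : R) (N : nat)
    (hT : 0 < T) (hrew : 0 < rew) (halpha : 1 < alpha)
    (hlambda : 0 < lambda) (hmu : 0 < mu) (hN : (0 < N)%N) :
  (exists P : 'I_N -> R,
     optimal alpha lambda mu T rew (uniform_schedule alpha lambda mu T rew N) P /\
     \sum_(i < N) P i = G alpha lambda mu T rew N) /\
  (forall (S : schedule N) (P : 'I_N -> R),
     optimal alpha lambda mu T rew S P ->
     S = uniform_schedule alpha lambda mu T rew N).
Proof.
have N0 : 0 < N%:R :> R by rewrite ltr0n.
have Tb0 : 0 < T / N%:R by rewrite divr_gt0.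
have Rb0 : 0 < rew / N%:R by rewrite divr_gt0.
have al0 : 0 < alpha by exact: lt_trans halpha.
pose B := best_goal alpha lambda mu; pose K := B (T / N%:R) (rew / N%:R).
have [c [d majorant]] := best_goal_majorant halpha hlambda hmu Tb0 Rb0.
have sumN (a : R) : \sum_(i < N) a = N%:R * a.
  by rewrite sumr_const card_ord mulr_natl.
have feas : feasible alpha lambda mu T rew (uniform_schedule alpha lambda mu T rew N)
  (fun=> K).
  split=> //=.
  - by move=> i; split; [exact: ltW|exact: ltW|exact: best_goal_ge0].
  - by rewrite sumN mulrC divfK// gt_eqF.
  - by rewrite sumN mulrC divfK// gt_eqF.
  - by move=> i; apply: best_goal_progress => //; exact: ltW.
have bound (S : schedule N) (P : 'I_N -> R) : feasible alpha lambda mu T rew S P ->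
    \sum_(i < N) P i <= N%:R * K /\
    (\sum_(i < N) P i = N%:R * K -> forall i,
      [/\ horizon S i = T / N%:R, reward S i = rew / N%:R & goal S i = K]).
  move=> [S0 ST Sr prog PS].
  pose m i := K + c * (horizon S i - T / N%:R) + d * (reward S i - rew / N%:R).
  have PB i : P i <= B (horizon S i) (reward S i).
    have [h0 r0 g0] := S0 i; rewrite PS; apply: progress_le_best_goal => //.
    by have := prog i; rewrite PS.
  have Bm i : B (horizon S i) (reward S i) <= m i.
    by have [h0 r0 _] := S0 i; have [] := majorant _ _ h0 r0.
  have summ : \sum_(i < N) m i = N%:R * K.
    rewrite !big_split/= [X in X + _ + _]sumN -!mulr_sumr !sumrB ST Sr !sumN.
    have -> : N%:R * (T / N%:R) = T by rewrite mulrC divfK// gt_eqF.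
    have -> : N%:R * (rew / N%:R) = rew by rewrite mulrC divfK// gt_eqF.
    by rewrite !subrr !mulr0 !addr0.
  split; first by rewrite -summ; apply: ler_sum => i _; exact: le_trans (Bm i).
  move=> sumP i.
  (* The gaps [m i - P i] are nonnegative and sum to 0. *)
  have Pm : P i = m i.
    apply/eqP; rewrite eq_sym -subr_eq0; apply/eqP.
    apply: (@psumr_eq0P _ _ xpredT (fun i => m i - P i)) => // [j _|].
      by rewrite subr_ge0 (le_trans (PB j)).
    by rewrite sumrB summ sumP subrr.
  have [h0 r0 _] := S0 i; have [_ eqm] := majorant _ _ h0 r0.
  have [hE rE] : horizon S i = T / N%:R /\ reward S i = rew / N%:R.
    by apply: eqm; apply/le_anti; rewrite Bm -[X in X <= _]Pm PB.
  by split=> //; rewrite -PS Pm /m hE rE !subrr !mulr0 !addr0.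
have GE : G alpha lambda mu T rew N = N%:R * K.
  have rE : rew = N%:R * (rew / N%:R) by rewrite mulrC divfK// gt_eqF.
  rewrite /G {1}rE (@powRM _ N%:R (rew / N%:R) _ (ltW N0) (ltW Rb0)).
  rewrite (@powRM _ N%:R _ _ (ltW N0) (F_ge0 _ _ _ _)) mulrACA -powRD; last first.
    by apply/implyP => _; rewrite gt_eqF.
  have -> : alpha^-1 + (alpha - 1) / alpha = 1 by field; rewrite gt_eqF.
  by rewrite powRr1 ?(ltW N0)// mulrCA.
split.
  exists (fun=> K); split; last by rewrite sumN GE.
  by split=> // S' P' /bound[]; rewrite sumN.
move=> S P [fS opt]; have [le eqs] := bound _ _ fS.
have ge := opt _ _ feas; rewrite sumN in ge.
have {}eqs := eqs (le_anti (introT andP (conj le ge))).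
case: S fS opt le ge eqs => h r g fS opt le ge /= eqs.
by rewrite /uniform_schedule; congr Schedule; apply/funext => i; have [] := eqs i.
Qed.
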